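(* Let $b\ge 2$ be an integer, $A=\{0,\dots,b-1\}$, and $P=\{2\}$. Let $T_P$ be the set of sequences $t_1t_2\cdots\in A^\omega$ with $t_n=t_{2n}$ for all $n\ge1$, and let $\mu$ be the push-forward under the Toeplitz transform $\tau_P$ of the uniform product probability measure $\lambda$ on $A^\omega$. Then $\mu$-almost every element of $T_P$ is the base-$b$ expansion of an absolutely normal number.
   Context: For $P=\{2\}$, the Toeplitz transform is $\tau_P(a_1a_2a_3\cdots)=t_1t_2t_3\cdots$ where $t_n=a_k$ whenever $n=j_k2^{e}$ with $e\ge0$, $j_k$ being the $k$-th odd positive integer in increasing order (so $j_k=2k-1$). Its image is $T_P$, and $\mu(X)=\lambda(\tau_P^{-1}(X))$ for measurable $X\subseteq T_P$. A sequence $a_1a_2\cdots$ is identified with the real number $\sum_{j\ge1}a_jb^{-j}$. A real number is simply normal to base $s$ if each digit of $\{0,\dots,s-1\}$ occurs in its base-$s$ expansion with asymptotic frequency $1/s$; normal to base $s$ if simply normal to all bases $s,s^2,s^3,\dots$; and absolutely normal if normal to every integer base $s\ge2$. *)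

(* Defs.v *)
From HB Require Import structures.
From mathcomp Require Import all_boot all_order all_algebra.
From mathcomp Require Import all_classical all_reals all_analysis.
From mathcomp Require Import zify.

Set Implicit Arguments.
Unset Strict Implicit.
Unset Printing Implicit Defensive.
Import Order.TTheory GRing.Theory Num.Theory.
Import numFieldNormedType.Exports.

Local Open Scope classical_set_scope.
Local Open Scope ring_scope.

(* For b >= 1 this is 'I_b; the predecessor-successor form makes the type
   inhabited for every b, as measurable types are required to be. *)
Definition alphabet (b : nat) := 'I_b.-1.+1.

HB.instance Definition _ (b : nat) := Finite.on (alphabet b).
HB.instance Definition _ (b : nat) := isPointed.Build (alphabet b) ord0.

Definition coordinate_sets (b : nat) : set (set (nat -> alphabet b)) :=
  [set X | exists i d, X = [set a | a i = d]].

(* A^omega with its product sigma-algebra. The function value [a i] is the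
   (i+1)-st term of the sequence; [term a n] below restores indexing from 1. *)
Definition oseq (b : nat) := g_sigma_algebraType (@coordinate_sets b).

HB.instance Definition _ (b : nat) := Measurable.on (oseq b).

Definition term (b : nat) (a : oseq b) (n : nat) : alphabet b := a n.-1.

(* The cylinder of a word of length n has measure b^-n; this determines lambda,
   and [uniform_product_exists] below shows that such a lambda exists. *)
Definition uniform_product (R : realType) (b : nat)
    (lambda : probability (oseq b) R) : Prop :=
  forall (n : nat) (w : 'I_n -> alphabet b),
    lambda [set a : oseq b | forall i : 'I_n, a i = w i] = ((b%:R^-1) ^+ n)%:E.

(* [n`_2^'] is the odd part of n, and the odd number j is the k-th one for
   k = (j + 1) / 2. *)
Definition toeplitz (b : nat) (a : oseq b) : oseq b :=
  fun i => term a (((i.+1)`_2^').+1./2)%N.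

Definition T2 (b : nat) : set (oseq b) :=
  [set t | forall n, (0 < n)%N -> term t n = term t (2 * n)%N].
Arguments T2 b : clear implicits.

(* A measure on all of A^omega, of total mass 1 on T2 ([toeplitz_measure_T2]). *)
Definition toeplitz_measure (R : realType) (b : nat)
    (lambda : probability (oseq b) R) : set (oseq b) -> \bar R :=
  pushforward lambda (@toeplitz b).

Definition represents (R : realType) (b : nat) (t : oseq b) (x : R) : Prop :=
  \sum_(1 <= j < n.+1) (term t j)%:R * b%:R ^- j @[n --> \oo] --> x.

(* The j-th digit (j >= 1) after the point of the base-s expansion of x. When x
   has two expansions this selects the one ending in zeros; both are eventually
   constant, so neither has the digit frequencies required below. *)
Definition digit (R : realType) (s : nat) (x : R) (j : nat) : int :=
  (Num.floor (x * s%:R ^+ j) %% s)%Z.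

Definition simply_normal_base (R : realType) (s : nat) (x : R) : Prop :=
  forall d : 'I_s,
    (\sum_(1 <= j < n.+1) (digit s x j == d :> int))%N%:R / n%:R @[n --> \oo]
      --> (s%:R^-1 : R).

Definition normal_base (R : realType) (s : nat) (x : R) : Prop :=
  forall k, (0 < k)%N -> simply_normal_base (s ^ k)%N x.

Definition absolutely_normal (R : realType) (x : R) : Prop :=
  forall s, (2 <= s)%N -> normal_base s x.

Section toeplitz_image.
Local Open Scope nat_scope.

Lemma term_toeplitz (b : nat) (a : oseq b) (k e : nat) : (0 < k)%N ->
  term (toeplitz a) ((2 * k).-1 * 2 ^ e)%N = term a k.
Proof.
move=> k0; have o : odd (2 * k).-1 by lia.
have n0 : (0 < (2 * k).-1 * 2 ^ e)%N by rewrite muln_gt0 expn_gt0 andbT; lia.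
rewrite {1}/term /toeplitz prednK// partnM ?expn_gt0//; last by lia.
rewrite part_pnat_id ?part_p'nat ?muln1.
- by congr term; lia.
- by rewrite pnatNK pnatX pnat_id.
- by rewrite p'natE// dvdn2 o.
Qed.

Lemma range_toeplitz (b : nat) : range (@toeplitz b) = T2 b.
Proof.
apply/seteqP; split=> [_ [a _ <-] n n0|t tT].
  have [k k0 [e ->]] : exists2 k, (0 < k)%N &
      exists e, n = ((2 * k).-1 * 2 ^ e)%N.
    have o : odd (n`_2^') by have := part_pnat 2^' n; rewrite p'natE// dvdn2 negbK.
    exists (n`_2^').+1./2; first by lia.
    exists (logn 2 n); rewrite -p_part mulnC -[LHS](partnC 2)//.
    by congr muln; lia.
  by rewrite mulnCA -expnS !term_toeplitz.
have tX n e : (0 < n)%N -> term t (n * 2 ^ e)%N = term t n.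
  move=> n0; elim: e => [|e IH]; first by rewrite muln1.
  by rewrite expnS mulnCA -tT ?muln_gt0 ?n0 ?expn_gt0.
exists (fun k => term t (2 * k.+1).-1) => //; apply/funext => i.
have o : odd ((i.+1)`_2^').
  by have := part_pnat 2^' i.+1; rewrite p'natE// dvdn2 negbK.
rewrite -[RHS]/(term t i.+1) -[in RHS](@partnC 2 i.+1)// mulnC p_part tX ?part_gt0//.
by rewrite /toeplitz {1}/term; congr term; lia.
Qed.

End toeplitz_image.

Lemma measurable_oseq (d : measure_display) (T : measurableType d) (b : nat)
    (f : T -> oseq b) :
  (forall i c, measurable [set x | f x i = c]) -> measurable_fun setT f.
Proof.
move=> mf; apply: (@measurability _ _ T (oseq b) setT f (@coordinate_sets b)) => //.
by move=> _ [_ [i [c ->]] <-]; rewrite setTI; exact: mf.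
Qed.

Lemma measurable_toeplitz (b : nat) : measurable_fun setT (@toeplitz b).
Proof.
apply: measurable_oseq => i c; apply: sub_sigma_algebra.
by exists (((i.+1)`_2^').+1./2.-1)%N, c.
Qed.

Lemma toeplitz_measure_T2 (R : realType) (b : nat)
    (lambda : probability (oseq b) R) :
  toeplitz_measure lambda (T2 b) = 1%E.
Proof.
rewrite /toeplitz_measure /pushforward -range_toeplitz preimage_range.
exact: probability_setT.
Qed.

Section lebesgue_uniform_product.
Variables (R : realType) (b : nat).
Hypothesis b_gt0 : (0 < b)%N.

Definition unit_measure : set (measurableTypeR R) -> \bar R :=
  mrestr (@lebesgue_measure R) (measurable_itv `[0, 1[).
Definition base_code (x : measurableTypeR R) : oseq b :=
  fun i => inord (Num.truncn (x * b%:R ^+ i.+1) %% b).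

Let b_gt0R : 0 < b%:R :> R. Proof. by rewrite ltr0n. Qed.

Let measurable_code : measurable_fun setT base_code.
Proof.
apply: measurable_oseq => i c.
pose E n := [set x : measurableTypeR R | (Num.truncn (x * b%:R ^+ i.+1) <= n)%N].
have mE n : measurable (E n).
  rewrite (_ : E n = `]-oo, n.+1%:R / b%:R ^+ i.+1[%classic); last first.
    apply/seteqP; split=> x;
      by rewrite /E/= in_itv/= truncn_le_nat ltr_pdivlMr ?exprn_gt0.
  exact: measurable_itv.
rewrite (_ : [set x | _] = \bigcup_(n in [set n | inord (n %% b) = c])
    (E n `\` (if n is m.+1 then E m else set0))); last first.
  apply/seteqP; split=> x /=.
    move=> <-; exists (Num.truncn (x * b%:R ^+ i.+1)) => //=; split; rewrite /E//=.
    by case tE: (Num.truncn _) => [|m] //=; apply/negP; rewrite tE -ltnNge.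
  move=> [n /= nc [xn xm]]; rewrite /base_code (_ : Num.truncn _ = n)//.
  apply/eqP; rewrite eqn_leq xn/=; case: n {nc xn} xm => // m /=.
  by move/negP; rewrite -ltnNge.
apply: bigcup_measurable => n _; apply: measurableD => //.
by case: n.
Qed.

HB.instance Definition _ := Measure.on unit_measure.

Let unit_measureT : unit_measure setT = 1%E.
Proof.
rewrite /unit_measure /mrestr setTI lebesgue_measure_itv/= lte_fin ltr01.
by rewrite oppr0 adde0.
Qed.

HB.instance Definition _ :=
  Measure_isProbability.Build _ _ _ unit_measure unit_measureT.
HB.instance Definition _ := isMeasurableFun.Build _ _ _ _ base_code measurable_code.

Let prefix (w : nat -> alphabet b) :=
  fix prefix n := if n is m.+1 then (b * prefix m + w m)%N else 0%N.

Let codeP (w : nat -> alphabet b) n x : 0 <= x < 1 ->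
  (forall i, (i < n)%N -> base_code x i = w i) <->
  Num.truncn (x * b%:R ^+ n) = prefix w n.
Proof.
move=> /andP[x0 x1].
have xb0 m : 0 <= x * b%:R ^+ m by rewrite mulr_ge0 ?exprn_ge0// ltW.
elim: n => [|n IH].
  split=> // _; apply/eqP; rewrite expr0 mulr1 truncn_eq//.
  by rewrite x0.
set k := Num.truncn (x * b%:R ^+ n) in IH *.
set l := Num.truncn (x * b%:R ^+ n.+1).
have [kl lk] : (b * k <= l)%N /\ (l < b * k.+1)%N.
  have /andP[h1 h2] := truncn_itv (xb0 n).
  rewrite truncn_ge_nat// truncn_lt_nat// exprSr mulrA !natrM ![b%:R * _]mulrC.
  by rewrite ler_pM2r// ltr_pM2r.
have wb m : (w m < b)%N by have := ltn_ord (w m); lia.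
have codeE : base_code x n = inord (l %% b) by [].
have lE : l = (b * k + (l %% b))%N.
  rewrite {1}(divn_eq l b) mulnC; congr (_ * _ + _)%N.
  apply/eqP; rewrite eqn_leq -ltnS ltn_divLR// leq_divRL//.
  by rewrite [(k * _)%N]mulnC kl mulnC lk.
split=> [h|h].
  have kE : k = prefix w n by apply/IH => i ?; apply: h; lia.
  have := h n (ltnSn n); rewrite codeE => /(congr1 val); rewrite /= inordK; last first.
    by rewrite prednK// ltn_pmod.
  by move=> lw; rewrite -kE -lw.
have lw : (l %% b)%N = w n.
  by rewrite h/= mulnC modnMDl modn_small.
have kE : k = prefix w n.
  move: lE; rewrite lw h /= => /addIn /eqP; rewrite eqn_pmul2l// => /eqP ->//.
move=> i; rewrite ltnS leq_eqVlt => /predU1P[->|]; last by move: i; apply/IH.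
by rewrite codeE lw; apply/val_inj; rewrite /= inordK.
Qed.

Lemma uniform_product_exists :
  exists lambda : probability (oseq b) R, uniform_product lambda.
Proof.
exists (distribution unit_measure base_code) => n w.
pose w' i : alphabet b := if insub i is Some j then w j else ord0.
have w'E (i : 'I_n) : w' i = w i by rewrite /w' valK.
have bn0 : 0 < b%:R ^+ n :> R by rewrite exprn_gt0.
have prefix_lt : (prefix w' n < b ^ n)%N.
  elim: n {w w'E bn0} w' => //= n IH w'.
  have := ltn_ord (w' n); have := IH w'; rewrite expnS; nia.
rewrite /distribution /pushforward /= /unit_measure /mrestr.
rewrite (_ : _ `&` _ = `[(prefix w' n)%:R / b%:R ^+ n,
    (prefix w' n).+1%:R / b%:R ^+ n[%classic); last first.
  apply/seteqP; split=> x /=; rewrite !in_itv/= ler_pdivrMr// ltr_pdivlMr//.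
    move=> [cx x01]; have /andP[x0 x1] := x01.
    have xb0 : 0 <= x * b%:R ^+ n by rewrite mulr_ge0// ltW.
    rewrite -truncn_eq//; apply/eqP/(codeP w' n x01) => i ni.
    by have := cx (Ordinal ni); rewrite /= => ->; rewrite -w'E.
  move=> /andP[h1 h2].
  have x0 : 0 <= x by rewrite -(pmulr_lge0 _ bn0) (le_trans _ h1).
  have x1 : x < 1.
    rewrite -(ltr_pM2r bn0) mul1r (lt_le_trans h2)// -natrX ler_nat//.
  have x01 : 0 <= x < 1 by rewrite x0.
  split=> // i; rewrite -w'E; have /(codeP w' n x01) : Num.truncn (x * b%:R ^+ n) = prefix w' n.
    by apply/eqP; rewrite truncn_eq ?mulr_ge0 ?h1// ltW.
  exact.
rewrite lebesgue_measure_itv/= lte_fin ltr_pM2r ?invr_gt0// ltr_nat ltnSn.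
by rewrite -EFinB -mulrBl -natrB// subSnn mul1r exprVn.
Qed.

End lebesgue_uniform_product.

(* Main.v *)
Require Import Defs.
From HB Require Import structures.
From mathcomp Require Import all_boot all_order all_algebra.
From mathcomp Require Import all_classical all_reals all_analysis.
From mathcomp Require Import complex cyclic zify ring lra.

(**
By Weyl's criterion it suffices that, for every base S and every h > 0, almost
surely the sums of e(h S^n x) over n < N are o(N). Their second moment is
the sum over m, n < N of the Fourier coefficients of the law of x at
l = h (S^m - S^n), and each coefficient is the product over the odd j of
phi(l (b^-j + b^-2j + b^-4j + ...)), where phi is the characteristic function of
one digit. Passing to a power of S we may write S = b^r S1, where either S1 = 1,
or S1 > 1 and some prime p | b has S1 = 1 mod p^2.

If S1 > 1, the numbers h (S^g - 1) S1^n, n < N, are distinct modulo b^k as soon as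
2^k is of order N^2 (lifting the exponent), and few residues modulo b^k have few
nonzero base-b digits (digits being read with sign). So for most n the
integer l has about log N positions i, near r n, with l b^-i far from the
integers. A given such i need not produce a small factor, since the terms
l b^-2i, l b^-4i, ... may compensate; but then one of these terms is itself far
from the integers. Moving up along such doublings one reaches a small factor near
some 2^E i, and boundedly many i lead to the same one.

If S1 = 1, one factor is nearly phi(h'/b) = 0, where h = b^v h' with b not
dividing h', unless the odd part of r m + v + 1, times some power of 2, is close
to r n + v.

Both cases bound the second moment by C gamma^L N^2 for 2^L <= N < 2^(L+1) and some
gamma < 1. The Borel-Cantelli lemma applies along N = i 2^j with
2^q <= i < 2^(q+1), which approximates every N up to a factor 1 + 2^-q.
*)
Set Implicit Arguments.
Unset Strict Implicit.
Unset Printing Implicit Defensive.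

(** * Arithmetic of powers *)

Section arithmetic.
Local Open Scope nat_scope.

Lemma subn1_expn y g : y ^ g - 1 = (y - 1) * \sum_(i < g) y ^ i.
Proof.
case: y => [|y]; first by rewrite sub0n mul0n; case: g => // g; rewrite exp0n.
elim: g => [|g IH]; first by rewrite big_ord0 muln0.
have : 0 < y.+1 ^ g by rewrite expn_gt0.
by rewrite big_ord_recr /= mulnDr -IH expnS; nia.
Qed.

Lemma sum_expn_mod d y g : y = 1 %[mod d] -> \sum_(i < g) y ^ i = g %[mod d].
Proof.
move=> y1; elim: g => [|g IH]; first by rewrite big_ord0.
by rewrite big_ord_recr /= -modnDm IH -modnXm y1 modnXm exp1n modnDm addn1.
Qed.

(* Lifting the exponent; the factor m lets the lemma be applied to products. *)
Lemma dvdn_exp_sub1 p v m y g : prime p -> y = 1 %[mod p ^ 2] ->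
  p ^ v %| m * (y ^ g - 1) -> p ^ v %| m * ((y - 1) * g).
Proof.
move=> pp; elim/ltn_ind: g m v => g IH m v y1 h.
have pmod z : z = 1 %[mod p ^ 2] -> z = 1 %[mod p].
  move=> z1; have pd : p %| p ^ 2 by rewrite dvdn_exp.
  by rewrite -(modn_dvdm z pd) z1 modn_dvdm.
case: g IH h => [|g] IH h; first by rewrite !muln0.
(* If p does not divide the exponent, the geometric sum is congruent to the exponent modulo p, hence
   prime to p, and cancels. *)
have [/dvdnP[g' gE]|pg] := boolP (p %| g.+1); last first.
  rewrite subn1_expn mulnA Gauss_dvdl in h; first by rewrite mulnA dvdn_mulr.
  rewrite coprimeXl// prime_coprime// /dvdn (sum_expn_mod _ (pmod _ y1)).
  exact: pg.
case: v h => [|v] h; first by rewrite expn0 dvd1n.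
have z1 : y ^ g' = 1 %[mod p ^ 2] by rewrite -modnXm y1 modnXm exp1n.
(* With z = y^g' congruent to 1 modulo p^2, the sum of z^i over i < p is p modulo p^2, so it carries
   exactly one factor p. The modulus p^2 enters here. *)
have [u uE pu] : exists2 u, \sum_(i < p) (y ^ g') ^ i = p * u & ~~ (p %| u).
  have pd : p %| \sum_(i < p) (y ^ g') ^ i.
    by rewrite /dvdn (sum_expn_mod _ (pmod _ z1)) modnn.
  case/dvdnP: pd => u uE; exists u; first by rewrite uE mulnC.
  apply/negP => /dvdnP[u' u'E].
  have := sum_expn_mod p z1; rewrite uE u'E -mulnA mulnn modnMl.
  have p1 := prime_gt1 pp; rewrite modn_small; first by lia.
  by rewrite -[X in X < _]expn1 ltn_exp2l.
rewrite gE expnM subn1_expn uE in h.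
have {}h : p ^ v %| m * (y ^ g' - 1).
  rewrite (_ : _ * _ = p * (m * (y ^ g' - 1) * u)) in h; last by ring.
  rewrite expnS dvdn_pmul2l ?prime_gt0// in h.
  by rewrite Gauss_dvdl in h; last rewrite coprimeXl// prime_coprime.
rewrite gE (_ : _ * _ = p * (m * ((y - 1) * g'))); last by ring.
rewrite expnS dvdn_pmul2l ?prime_gt0//; apply: IH => //.
have := prime_gt1 pp; nia.
Qed.

(** Cross-multiplied form of the minimum of f / g; it selects the prime of b at which the ratio of
    the valuations of S and b is least. *)
Lemma seq_min_ratio (T : eqType) (f g : T -> nat) (s : seq T) :
  s != [::] -> (forall x, x \in s -> 0 < g x) ->
  exists2 x, x \in s & forall y, y \in s -> f x * g y <= f y * g x.
Proof.
elim: s => //= a s IH _ gs.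
have [->|s0] := eqVneq s [::].
  by exists a; rewrite ?mem_head// => y; rewrite inE => /eqP ->.
have [x xs hx] := IH s0 (fun x xs => gs x (@mem_behead _ (a :: s) x xs)).
have gx : 0 < g x by rewrite gs// inE xs orbT.
have [fxa|fax] := leqP (f x * g a) (f a * g x).
  by exists x; rewrite ?inE ?xs ?orbT// => y; rewrite inE => /predU1P[->//|/hx].
exists a; rewrite ?mem_head// => y; rewrite inE => /predU1P[->//|ys].
have := hx _ ys => h.
rewrite -(leq_pmul2r gx); apply: (@leq_trans (f x * g a * g y)); first by nia.
nia.
Qed.

(* The prime p | b minimising v_p(S)/v_p(b) makes the greatest power of b
   dividing a suitable power of S leave a cofactor prime to p. *)
Lemma base_decomposition b S : 1 < b -> 1 < S ->
  exists a r S1, [/\ 0 < a, S ^ a = b ^ r * S1 &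
    S1 = 1 \/ 1 < S1 /\ exists2 p, prime p & p %| b /\ S1 = 1 %[mod p ^ 2]].
Proof.
move=> b1 S1; have b0 : 0 < b by lia. have S0 : 0 < S by lia.
have [||p pb pmin] := @seq_min_ratio _ (logn^~ S) (logn^~ b) (primes b).
- by have := pi_pdiv b; rewrite b1 /= /pi_of; case: (primes b).
- by move=> x; rewrite logn_gt0.
have pp : prime p by move: pb; rewrite mem_primes => /andP[].
have pdb : p %| b by move: pb; rewrite mem_primes => /and3P[].
have s0 : 0 < logn p b by rewrite logn_gt0.
set s := logn p b in s0 pmin; set r := logn p S in pmin.
(* Compared prime by prime: minimality says v_q(b) v_p(S) <= v_q(S) v_p(b) for every prime q
   dividing b. *)
have /dvdnP[S' S'E] : b ^ r %| S ^ s.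
  have [->|r0] := posnP r; first by rewrite expn0 dvd1n.
  apply/dvdn_partP; first by rewrite expn_gt0 b0.
  move=> q; rewrite /pi_of primesX// => qb.
  have qp : prime q by move: qb; rewrite mem_primes => /andP[].
  by rewrite p_part lognX pfactor_dvdn ?expn_gt0 ?S0// lognX [s * _]mulnC pmin.
have S'0 : 0 < S' by move: S'E; case: S' => // /eqP; rewrite mul0n expn_eq0; lia.
have pS' : coprime S' p.
  rewrite coprime_sym prime_coprime//; apply/negP => pS'.
  have : logn p (S ^ s) = logn p (S' * b ^ r) by rewrite S'E.
  rewrite lognM ?expn_gt0 ?b0// !lognX -/s -/r mulnC => h.
  have : 0 < logn p S' by rewrite logn_gt0 mem_primes pp S'0.
  lia.
have [S'1|S'n1] := eqVneq S' 1.
  by exists s, r, 1; split; [|rewrite S'E S'1 mulnC|left].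
(* By Euler's theorem a further power [totient (p ^ 2)] makes the cofactor 1 modulo p^2. *)
have t0 : 0 < totient (p ^ 2) by rewrite totient_gt0 expn_gt0 prime_gt0.
exists (s * totient (p ^ 2)), (r * totient (p ^ 2)), (S' ^ totient (p ^ 2)); split.
- by rewrite muln_gt0 s0.
- by rewrite expnM S'E expnMn -expnM mulnC.
- right; split.
    by rewrite -{1}(exp1n (totient (p ^ 2))) ltn_exp2r//; lia.
  by exists p => //; split => //; apply: Euler_exp_totient; rewrite coprimeXr.
Qed.

(** A congruence would hold modulo p^k as well. Cancelling S1^n1, which is prime to p, and lifting
    the exponent, p^k would divide h (S1 - 1)^2 (n2 - n1) g, a positive number below 2^k. *)
Lemma expn_mod_inj p b k h S S1 r N g n1 n2 : prime p -> 0 < b -> p %| b ->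
  S1 = 1 %[mod p ^ 2] -> 1 < S1 -> S = b ^ r * S1 -> 0 < h -> 0 < g < N ->
  n1 < n2 < N -> h * S1 ^ 2 * N ^ 2 < 2 ^ k ->
  h * (S ^ g - 1) * S1 ^ n1 != h * (S ^ g - 1) * S1 ^ n2 %[mod b ^ k].
Proof.
move=> pp b0 pb S11 S1gt SE h0 /andP[g0 gN] /andP[n12 n2N] hk; apply/negP => /eqP eq12.
have p1 := prime_gt1 pp.
have pS1 : coprime p S1.
  rewrite coprime_sym /coprime -gcdn_modl.
  have pd : p %| p ^ 2 by rewrite dvdn_exp.
  by rewrite -(modn_dvdm S1 pd) S11 modn_dvdm// gcdn_modl gcd1n.
have {}eq12 : h * (S ^ g - 1) * S1 ^ n2 = h * (S ^ g - 1) * S1 ^ n1 %[mod p ^ k].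
  have pd : p ^ k %| b ^ k by rewrite dvdn_exp2r.
  by rewrite -(modn_dvdm _ pd) -eq12 modn_dvdm.
have S1n : S1 ^ n2 = S1 ^ n1 * S1 ^ (n2 - n1) by rewrite -expnD; congr (_ ^ _); lia.
have S1d0 : 0 < S1 ^ (n2 - n1) by rewrite expn_gt0; lia.
move/eqP: eq12; rewrite eqn_mod_dvd; last by rewrite leq_mul2l S1n leq_pmulr ?orbT.
rewrite -mulnBr S1n -{2}[S1 ^ n1]muln1 -mulnBr mulnCA Gauss_dvdr; last first.
  by rewrite coprimeXl// coprimeXr.
move/(dvdn_exp_sub1 pp S11).
set d := n2 - n1; have /andP[d0 dN] : 0 < d < N by lia.
rewrite (_ : h * (S ^ g - 1) * _ = h * (S1 - 1) * d * (S ^ g - 1)); last by ring.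
move=> hd.
have {}hd : p ^ k %| h * (S1 - 1) * d * ((S1 - 1) * g).
  (* If r = 0 then S = S1 and the exponent is lifted a second time; otherwise p divides S and S^g -
     1 is prime to p. *)
  have [r0|r0] := posnP r.
    by apply: (dvdn_exp_sub1 pp S11); move: hd; rewrite SE r0 expn0 mul1n.
  move: hd; rewrite Gauss_dvdl => [hd|]; first exact: dvdn_mulr.
  rewrite coprimeXl// prime_coprime//; apply/negP => pS.
  have pSg : p %| S ^ g by rewrite dvdn_exp// SE dvdn_mulr// dvdn_exp.
  have Sg0 : 0 < S ^ g by rewrite expn_gt0 SE muln_gt0 expn_gt0 b0 (ltnW S1gt).
  have := dvdn_sub pSg pS; by rewrite subKn// dvdn1 => /eqP pE; rewrite pE in p1.
have le1 : p ^ k <= h * (S1 - 1) * d * ((S1 - 1) * g).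
  by apply: dvdn_leq hd; rewrite !muln_gt0 h0 d0 g0 /= subn_gt0 S1gt.
have le2 : 2 ^ k <= p ^ k by case: (k) => // k'; rewrite leq_exp2r.
have le3 : h * (S1 - 1) * d * ((S1 - 1) * g) <= h * S1 ^ 2 * N ^ 2.
  rewrite (_ : _ * _ = h * (S1 - 1) ^ 2 * (d * g)); last by rewrite -mulnn; ring.
  rewrite leq_mul ?leq_mul2l ?leq_exp2r ?leq_subr ?orbT//.
  by rewrite -mulnn leq_mul// ltnW.
by have := leq_trans hk (leq_trans le2 (leq_trans le1 le3)); rewrite ltnn.
Qed.

End arithmetic.

Import Order.TTheory GRing.Theory Num.Theory.
Import numFieldNormedType.Exports.
Import Normc.
Local Open Scope ring_scope.

Lemma sum_ord_muln (V : nmodType) (F : nat -> V) c B :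
  \sum_(n < c * B) F n = \sum_(j < c) \sum_(i < B) F (i + j * B)%N.
Proof.
rewrite -(big_mkord xpredT F); elim: c => [|c IHc]; first by rewrite mul0n big_ord0 big_geq.
rewrite big_ord_recr /= -IHc mulSn addnC (@big_cat_nat _ _ _ (c * B))//=; last by lia.
congr (_ + _); rewrite -{1}[(c * B)%N]add0n big_addn addKn.
by rewrite big_mkord.
Qed.

(** * Signed digits and the distance to the nearest integer *)

Section nearest_integer.
Variable R : realType.
Implicit Types x y : R.

Definition nint_dist x : R := `|x - (Num.floor (x + 2^-1))%:~R|.

Lemma nint_dist_ge0 x : 0 <= nint_dist x. Proof. exact: normr_ge0. Qed.

Lemma nint_dist_le_half x : nint_dist x <= 2^-1.
Proof.
rewrite /nint_dist ler_norml.
have := floor_le_tmp (x + 2^-1); have := floorD1_gt (x + 2^-1).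
rewrite intrD; lra.
Qed.

Lemma nint_dist_le x (k : int) : nint_dist x <= `|x - k%:~R|.
Proof.
have [->//|kn] := eqVneq k (Num.floor (x + 2^-1)).
have h := nint_dist_le_half x; apply: (le_trans h).
rewrite leNgt; apply/negP => xk; move/eqP: kn; apply.
apply/esym/floor_def; move: xk; rewrite ltr_norml intrD => /andP[h1 h2].
apply/andP; split; lra.
Qed.

Lemma nint_dist_le_norm x : nint_dist x <= `|x|.
Proof. by have := nint_dist_le x 0; rewrite subr0. Qed.

Lemma nint_dist_int (k : int) : nint_dist k%:~R = 0.
Proof. by apply/eqP; rewrite eq_le nint_dist_ge0 andbT (le_trans (nint_dist_le _ k))// subrr normr0. Qed.

Lemma nint_distDint x (k : int) : nint_dist (x + k%:~R) = nint_dist x.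
Proof.
suff h y (j : int) : nint_dist (y + j%:~R) <= nint_dist y.
  by apply/eqP; rewrite eq_le h /=; have := h (x + k%:~R) (- k); rewrite mulrNz addrK.
apply: le_trans (nint_dist_le _ (Num.floor (y + 2^-1) + j)) _.
by rewrite intrD opprD addrACA subrr addr0.
Qed.

Lemma nint_distD x y : nint_dist (x + y) <= nint_dist x + nint_dist y.
Proof.
apply: le_trans (nint_dist_le _ (Num.floor (x + 2^-1) + Num.floor (y + 2^-1))) _.
by rewrite intrD opprD addrACA ler_normD.
Qed.

Lemma nint_distN x : nint_dist (- x) = nint_dist x.
Proof.
suff h y : nint_dist (- y) <= nint_dist y by apply/eqP; rewrite eq_le h; have := h (- x); rewrite opprK.
apply: le_trans (nint_dist_le _ (- Num.floor (y + 2^-1))) _.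
by rewrite mulrNz -opprD normrN.
Qed.

Lemma nint_dist_sum (I : Type) (s : seq I) (P : pred I) (F : I -> R) :
  nint_dist (\sum_(i <- s | P i) F i) <= \sum_(i <- s | P i) nint_dist (F i).
Proof.
elim/big_ind2: _ => //; first by rewrite (nint_dist_int 0).
by move=> x1 x2 y1 y2 h1 h2; apply: le_trans (nint_distD _ _) _; exact: lerD.
Qed.

Lemma nint_dist_mulrn_le x (n : nat) : nint_dist (n%:R * x) <= n%:R * nint_dist x.
Proof.
apply: le_trans (nint_dist_le _ (n%:Z * Num.floor (x + 2^-1))) _.
by rewrite intrM -mulrBr normrM ger0_norm ?ler0n.
Qed.

Lemma nint_dist_small x : `|x| <= 2^-1 -> nint_dist x = `|x|.
Proof.
move=> x2; apply/eqP; rewrite eq_le nint_dist_le_norm /= /nint_dist.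
set k := Num.floor _; have [->|k0] := eqVneq k 0; first by rewrite subr0.
have : 1 <= `|k%:~R : R|.
  by rewrite -intr_norm -[1]/(1%:~R) ler_int; move: k0; lia.
move=> k1; have := lerB_dist k%:~R x; rewrite distrC.
by move=> /(le_trans _); apply; lra.
Qed.

(** Below the threshold 1 / (2n) the multiple does not wrap around, so the scaling is exact. *)
Lemma nint_dist_mulrn x (n : nat) : (0 < n)%N -> nint_dist x < (2 * n%:R)^-1 ->
  nint_dist (n%:R * x) = n%:R * nint_dist x.
Proof.
move=> n0 xn.
have -> : n%:R * x = n%:R * (x - (Num.floor (x + 2^-1))%:~R)
    + (n%:Z * Num.floor (x + 2^-1))%:~R.
  by rewrite intrM -mulrDr subrK.
rewrite nint_distDint nint_dist_small normrM ger0_norm ?ler0n// -/(nint_dist x).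
have n0' : 0 < n%:R :> R by rewrite ltr0n.
by rewrite -ler_pdivlMl// ltW// -invfM mulrC.
Qed.

End nearest_integer.

(** * Residues with few positions far from the integers *)

Section digits.
Variables (R : realType) (b : nat).
Hypothesis b_ge2 : (2 <= b)%N.

Let b0 : 0 < b%:R :> R. Proof. by rewrite ltr0n; lia. Qed.
Let bX0 i : 0 < b%:R ^+ i :> R. Proof. exact: exprn_gt0. Qed.

(** Depends on l only modulo b^i; it is small when the digits of l just below place i are a long run
    of 0 or a long run of b - 1. *)
Definition dshift (l i : nat) : R := nint_dist (l%:R / b%:R ^+ i).

Lemma dshift0 l : dshift l 0 = 0.
Proof. by rewrite /dshift expr0 divr1 -[l%:R]/(l%:Z%:~R) nint_dist_int. Qed.

Lemma dshiftS l i : l%:R / b%:R ^+ i = b%:R * (l%:R / b%:R ^+ i.+1) :> R.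
Proof. by rewrite exprS; field; rewrite !gt_eqF. Qed.

Lemma dshiftS_le l i : dshift l i <= b%:R * dshift l i.+1.
Proof. by rewrite /dshift dshiftS nint_dist_mulrn_le. Qed.

(** Lowering i by one multiplies l / b^i by b, and the distance grows by exactly this factor while
    it is below 1 / (2b). *)
Lemma dshift_amplify l t i : (b%:R ^+ t.+1 * 2)^-1 <= dshift l i ->
  exists2 s, (s <= t)%N /\ (s < i)%N & (2 * b%:R)^-1 <= dshift l (i - s).
Proof.
elim: t i => [|t IH] i h.
  exists 0%N; last by rewrite subn0 mulrC -[X in X * 2]expr1.
  split=> //; case: i h => //; rewrite dshift0 invr_le0 leNgt.
  by rewrite mulr_gt0.
have [hi|hi] := leP (2 * b%:R)^-1 (dshift l i).
  exists 0%N; rewrite ?subn0//; split=> //; case: i h {hi} => //.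
  by rewrite dshift0 invr_le0 leNgt mulr_gt0.
case: i h hi => [|i] h hi.
  by move: h; rewrite dshift0 invr_le0 leNgt mulr_gt0.
have e : dshift l i = b%:R * dshift l i.+1.
  by rewrite /dshift dshiftS nint_dist_mulrn//; lia.
have [|s [st si] hs] := IH i.
  by rewrite e -ler_pdivrMl// -invfM mulrA -exprS.
by exists s.+1; rewrite ?subSS//; split; lia.
Qed.

Lemma dshift_modl l k i : (i <= k)%N -> dshift (l %% b ^ k) i = dshift l i.
Proof.
move=> ik; rewrite /dshift {2}(divn_eq l (b ^ k)) natrD mulrDl addrC natrM natrX.
have -> : (l %/ b ^ k)%:R * b%:R ^+ k / b%:R ^+ i
    = ((l %/ b ^ k * b ^ (k - i))%N%:Z)%:~R :> R.
  have -> : b%:R ^+ k = b%:R ^+ (k - i) * b%:R ^+ i :> R by rewrite -exprD subnK.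
  rewrite -[RHS]/((_ * _)%N%:R) natrM natrX.
  by field; rewrite !gt_eqF.
by rewrite nint_distDint.
Qed.

(** Plays the part of the number of nonzero signed digits of l modulo b^k. *)
Definition heavy (l k : nat) : nat :=
  (\sum_(1 <= i < k.+1) ((2 * b%:R)^-1 <= dshift l i)%R)%N.

Lemma heavy_modl l k : heavy (l %% b ^ k) k = heavy l k.
Proof. by apply: eq_big_nat => i /andP[_ ik]; rewrite dshift_modl. Qed.

Lemma heavyS l k : heavy l k.+1 = (heavy l k + ((2 * b%:R)^-1 <= dshift l k.+1)%R)%N.
Proof. by rewrite /heavy big_nat_recr. Qed.

Lemma heavy_addM l d k : heavy (l + d * b ^ k) k = heavy l k.
Proof. by rewrite -heavy_modl addnC modnMDl heavy_modl. Qed.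

(* Distinct leading digits move l / b^(k+1) by at least 1/b modulo 1. *)
Lemma light_digit_uniq l k (d1 d2 : 'I_b) :
  dshift (l + d1 * b ^ k) k.+1 < (2 * b%:R)^-1 ->
  dshift (l + d2 * b ^ k) k.+1 < (2 * b%:R)^-1 -> d1 = d2.
Proof.
wlog lt12 : d1 d2 / (d1 < d2)%N => [wl|] h1 h2.
  by case: (ltngtP d1 d2) => [/wl->//|/wl->//|/val_inj].
suff : b%:R^-1 <= dshift (l + d1 * b ^ k) k.+1 + dshift (l + d2 * b ^ k) k.+1.
  move: h1 h2; rewrite invfM; move: (dshift _ _) (dshift _ _) => *.
  by exfalso; lra.
rewrite {1}/dshift -nint_distN addrC; apply: le_trans (nint_distD _ _).
rewrite -mulrBl -natrB; last by rewrite leq_add2l leq_mul2r ltnW// orbT.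
rewrite subnDl -mulnBl natrM natrX exprSr.
set d := (d2 - d1)%N; rewrite (_ : _ / _ = b%:R^-1 * d%:R); last first.
  by field; rewrite !gt_eqF.
 have /andP[d0 db] : (0 < d < b)%N by have := ltn_ord d2; lia.
rewrite /nint_dist; set m := Num.floor _.
have -> : b%:R^-1 * d%:R - m%:~R = b%:R^-1 * (d%:Z - m * b%:Z)%:~R :> R.
  by rewrite intrB intrM -!pmulrn; field; rewrite gt_eqF.
rewrite normrM gtr0_norm ?invr_gt0// ler_pMr ?invr_gt0//.
rewrite -intr_norm -[1]/(1%:~R) ler_int.
suff : d%:Z - m * b%:Z != 0 by lia.
apply/negP => /eqP e; have {}e : d%:Z = m * b%:Z by lia.
by have [m0|m0] := ler0P m; nia.
Qed.

(* At most one choice of the next digit leaves the next position light, so each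
   position contributes a factor of at most 1 + b z. *)
Lemma sum_heavy (z : R) k : 0 <= z <= 1 ->
  \sum_(r < b ^ k) z ^+ heavy r k <= (1 + b%:R * z) ^+ k.
Proof.
move=> /andP[z0 z1]; elim: k => [|k IH].
  by rewrite expn0 big_ord1 /heavy big_geq// !expr0.
pose F r := z ^+ heavy r k.+1.
have -> : \sum_(r < b ^ k.+1) z ^+ heavy r k.+1
    = \sum_(r < b ^ k) \sum_(d < b) F (r + d * b ^ k)%N.
  rewrite (eq_bigr (fun r : 'I_(b ^ k.+1) => F r))// exchange_big /= expnS.
  exact: sum_ord_muln.
rewrite exprSr; apply: le_trans (ler_wpM2r _ IH); last first.
  by rewrite addr_ge0// mulr_ge0// ltW.
rewrite mulr_suml; apply: ler_sum => r _.
have FE (d : 'I_b) : F (r + d * b ^ k)%N = z ^+ heavy r k *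
    z ^+ ((2 * b%:R)^-1 <= dshift (r + d * b ^ k) k.+1)%R.
  by rewrite /F heavyS exprD heavy_addM.
rewrite (eq_bigr _ (fun d _ => FE d)) -mulr_sumr ler_wpM2l ?exprn_ge0//.
have [/existsP[d0 hd0]|/existsPn no] :=
    boolP [exists d : 'I_b, dshift (r + d * b ^ k) k.+1 < (2 * b%:R)^-1].
  rewrite (bigD1 d0)//= lerD//; first exact: exprn_ile1.
  apply: (@le_trans _ _ (\sum_(d < b | d != d0) z)).
    apply: ler_sum => d dd0.
    suff -> : (2 * b%:R)^-1 <= dshift (r + d * b ^ k) k.+1 by rewrite expr1.
    rewrite leNgt; apply/negP => hd; move/eqP: dd0; apply.
    exact: light_digit_uniq hd hd0.
  rewrite sumr_const -[z *+ _]mulr_natl ler_wpM2r// ler_nat.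
  by rewrite -[X in (_ <= X)%N]card_ord max_card.
apply: (@le_trans _ _ (\sum_(d < b) z)).
  by apply: ler_sum => d _; rewrite [((2 * _)^-1 <= _)%R]leNgt no expr1.
rewrite sumr_const card_ord -mulr_natl; lra.
Qed.

End digits.

(** * Doubling chains and good indices *)

Section chain.
Variables (R : realType) (b : nat).
Hypothesis b_ge2 : (2 <= b)%N.

Let b0 : 0 < b%:R :> R. Proof. by rewrite ltr0n; lia. Qed.
Let b2 : 2 <= b%:R :> R. Proof. by rewrite ler_nat. Qed.
Let bX0 i : 0 < b%:R ^+ i :> R. Proof. exact: exprn_gt0. Qed.

(** For odd i, all places i 2^e carry the same digit; this is the coefficient of that digit in l
    times the number truncated after M digits. *)
Definition toeplitz_sum (l M i : nat) : R :=
  \sum_(e < M.+1 | (i * 2 ^ e <= M)%N) l%:R / b%:R ^+ (i * 2 ^ e).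

Let c0 : R := (2 * b%:R ^+ 2)^-1.

Definition good (l M i : nat) := c0 / 2 <= nint_dist (toeplitz_sum l M i).

Let c00 : 0 < c0. Proof. by rewrite invr_gt0 mulr_gt0. Qed.

(** Independent digits sit at odd places. Passing from an even i to i + 1 loses at most a factor b,
    which explains the constant [c0]. *)
Lemma odd_heavy l i : (2 * b%:R)^-1 <= dshift R b l i ->
  exists2 i', odd i' & (i <= i' <= i.+1)%N /\ c0 <= dshift R b l i'.
Proof.
move=> h; have c0E : c0 = (2 * b%:R)^-1 / b%:R by rewrite /c0 expr2; field; rewrite gt_eqF.
have [oi|ei] := boolP (odd i).
  exists i => //; split; first by lia.
  apply: le_trans h; rewrite c0E ler_pdivrMr// -[X in X <= _]mulr1.
  by rewrite ler_wpM2l ?invr_ge0 ?mulr_ge0// ler1n; lia.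
exists i.+1 => //; split; first by lia.
by rewrite c0E ler_pdivrMr// [leRHS]mulrC; apply: (le_trans h); exact: dshiftS_le.
Qed.

(* If the term l / b^i is far from the integers but the whole sum is not, some term
   l / b^(i 2^e) is at distance at least c0 / 2^(e+1); multiplying it by b^s with
   s <= e + 2 brings it back to a fixed distance. *)
Lemma chain_step l M i : (i <= M)%N -> c0 <= dshift R b l i -> ~ good l M i ->
  exists e i', [/\ (0 < e)%N, odd i', (2 ^ e * i <= i' + e + 2)%N,
    (i' <= 2 ^ e * i + 1)%N & c0 <= dshift R b l i'].
Proof.
move=> iM hi /negP; rewrite -ltNge => ng.
(* Otherwise the doubled terms add up to at most c0 / 2, and the term at i itself would be below
   c0. *)
have : exists e : 'I_M, c0 / 2 / 2 ^+ e.+1 <= dshift R b l (i * 2 ^ e.+1).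
  apply/existsP; apply: contraT => /existsPn no.
  suff : dshift R b l i < c0 by rewrite ltNge hi.
  have -> : c0 = c0 / 2 + c0 / 2 by field.
  have -> : dshift R b l i = nint_dist (toeplitz_sum l M i -
      \sum_(e < M | (i * 2 ^ e.+1 <= M)%N) l%:R / b%:R ^+ (i * 2 ^ e.+1)).
    rewrite /toeplitz_sum big_mkcond big_ord_recl /= expn0 muln1 iM.
    by rewrite -big_mkcond addrK.
  apply: le_lt_trans (nint_distD _ _) _; rewrite nint_distN ltr_leD//.
  apply: le_trans (nint_dist_sum _ _ _) _.
  apply: (@le_trans _ _ (\sum_(e < M) c0 / 2 / 2 ^+ e.+1)).
    rewrite big_mkcond; apply: ler_sum => e _; case: ifP => _.
      by rewrite ltW// ltNge no.
    by rewrite !divr_ge0 ?exprn_ge0// ltW.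
  rewrite -mulr_sumr ger_pMr ?divr_gt0//.
  suff -> : \sum_(e < M) (2 ^+ e.+1)^-1 = 1 - (2 ^+ M)^-1 :> R.
    by rewrite gerBl invr_ge0 exprn_ge0.
  elim: M {iM ng no} => [|M IH]; first by rewrite big_ord0 expr0 invr1 subrr.
  rewrite big_ord_recr /= IH exprS invfM; lra.
case=> [[e eM] /= he].
(* Since 2 <= b, the distance c0 / 2^(e+2) is at least 1 / (2 b^(e+4)), as amplification with t = e
   + 3 requires. *)
have [|s [sl si] hs] := @dshift_amplify R b b_ge2 l e.+3 (i * 2 ^ e.+1).
  apply: le_trans he; rewrite /c0 -!invfM.
  have p1 : 0 < b%:R ^+ e.+4 * 2 :> R by apply: mulr_gt0 => //; exact: exprn_gt0.
  have p2 : 0 < 2 * b%:R ^+ 2 * 2 * 2 ^+ e.+1 :> R.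
    by rewrite !mulr_gt0 ?exprn_gt0.
  rewrite lef_pV2 ?posrE ?p1 ?p2 {p1 p2}//.
  have -> : b%:R ^+ e.+4 * 2 = b%:R ^+ 2 * (2 * b%:R ^+ e.+2) :> R.
    by rewrite (exprD _ 2 e.+2); ring.
  have -> : 2 * b%:R ^+ 2 * 2 * 2 ^+ e.+1 = b%:R ^+ 2 * (2 * 2 ^+ e.+2) :> R.
    by rewrite (exprS _ e.+1); ring.
  rewrite (ler_pM2l (bX0 2)) (ler_pM2l (ltr0Sn R 1)).
  by apply: lerXn2r; rewrite ?nnegrE.
have [i' oi' [ii' hi']] := odd_heavy hs.
by exists e.+1, i'; split=> //; move: ii' sl si; clear; lia.
Qed.

(* The bounds say that i' stays in [2^E (i - 3) + 3, 2^E (i + 1) - 1]; this shape is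
   stable under chain_step, because e + 2 <= 3 (2^e - 1). *)
Lemma chain l M i : (2 * b ^ 2 * l < b ^ M)%N -> odd i -> (4 <= i)%N ->
  c0 <= dshift R b l i ->
  exists E i', [/\ odd i', (i' <= M)%N, good l M i',
    (2 ^ E * i + 3 <= i' + 2 ^ E * 3)%N & (i' + 1 <= 2 ^ E * (i + 1))%N].
Proof.
move=> lM; have leM j : c0 <= dshift R b l j -> (j <= M)%N.
  rewrite leqNgt => hj; apply/negP => Mj.
  have : c0 <= l%:R / b%:R ^+ j.
    by apply: le_trans hj _; apply: le_trans (nint_dist_le_norm _) _; rewrite ger0_norm// divr_ge0// ltW.
  rewrite /c0 ler_pdivlMr// mulrC ler_pdivrMr ?mulr_gt0//.
  rewrite -!natrX -!natrM ler_nat leqNgt => /negP; apply.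
  have : (b ^ M <= b ^ j)%N by rewrite leq_exp2l// ltnW.
  by move: lM; rewrite mulnC; exact: leq_trans.
(* Each step of the chain reaches a larger index, and [leM] keeps the indices at most M. *)
move en : (M - i)%N => n; elim/ltn_ind: n i en => n IH i en oi i4 hi.
have iM := leM _ hi.
have [g|/negP/(chain_step iM hi)] := boolP (good l M i).
  by exists 0%N, i; split=> //; lia.
move=> [e [i1 [e0 o1 l1 u1 h1]]].
have [e2 e2'] : (2 * e <= 2 ^ e)%N /\ (e + 2 <= 3 * (2 ^ e - 1))%N.
  case: e e0 {l1 u1} => // e _; elim: e => // e; rewrite (expnS _ e.+1); lia.
have i1i : (i < i1)%N.
  have : (2 ^ e * i = i + (2 ^ e - 1) * i)%N by rewrite -mulSn; congr (_ * _)%N; lia.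
  nia.
have i1M := leM _ h1.
have lt_n : (M - i1 < n)%N by lia.
have i14 : (4 <= i1)%N by lia.
have [E [i' [odd_i' iM' g' l' u']]] := IH _ lt_n i1 erefl o1 i14 h1.
exists (E + e)%N, i'; split=> //; rewrite expnD.
- apply: (@leq_trans (2 ^ E * (i1 + (e + 2)) + 3)%N).
    by rewrite leq_add2r -mulnA leq_mul2l; lia.
  apply: (@leq_trans (i' + 2 ^ E * 3 + 2 ^ E * (3 * (2 ^ e - 1)))%N).
    by rewrite mulnDr; have : (2 ^ E * (e + 2) <= 2 ^ E * (3 * (2 ^ e - 1)))%N;
      [rewrite leq_mul2l e2' orbT|lia].
  by rewrite -addnA leq_add2l -mulnDr -mulnA leq_mul2l; lia.
- apply: leq_trans u' _; rewrite -mulnA leq_mul2l; nia.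
Qed.

(* A good i' reached from both i and j determines E up to at most T values, and
   then i up to 5 values. *)
Lemma card_good l M A A' T : (0 < T)%N -> (2 * b ^ 2 * l < b ^ M)%N -> (4 <= A)%N ->
  (A' + 1 < 2 ^ T * (A - 3))%N ->
  (#|[set i : 'I_A'.+1 | [&& odd i, (A <= i)%N & (c0 <= dshift R b l i)%R]]| <=
   #|[set i : 'I_M.+1 | odd i && good l M i]| * (T * 5))%N.
Proof.
move=> T0 lM A4 AT; set J := [set i | _]; set G := [set i : 'I_M.+1 | _].
have /choice[E hE] (i : 'I_A'.+1) : exists Ei : nat * 'I_M.+1, i \in J ->
    [/\ Ei.2 \in G, (2 ^ Ei.1 * i + 3 <= Ei.2 + 2 ^ Ei.1 * 3)%N &
     (Ei.2 + 1 <= 2 ^ Ei.1 * (i + 1))%N].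
  have [|_] := boolP (i \in J); last by exists (0%N, ord0).
  rewrite inE => /and3P[oi Ai hi].
  have [E [i' [odd_i' iM' g' l' u']]] := chain lM oi (leq_trans A4 Ai) hi.
  exists (E, Ordinal (n := M.+1) (m := i') iM') => _ /=.
  by rewrite inE /= odd_i' g'.
pose F (i : 'I_A'.+1) : 'I_M.+1 * ('I_T * 'I_5) :=
  ((E i).2, (Ordinal (ltn_pmod (E i).1 T0), Ordinal (ltn_pmod i (isT : (0 < 5)%N)))).
have Finj : {in J &, injective F}.
  move=> i j iJ jJ; case=> e1 e2 e3; apply/val_inj => /=.
  have [_ li ui] := hE _ iJ; have [_ lj uj] := hE _ jJ.
  rewrite -e1 in lj uj.
  move: iJ jJ; rewrite !inE => /and3P[_ Ai _] /and3P[_ Aj _].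
  have iA := ltn_ord i; have jA := ltn_ord j.
  move: (E i).1 (E j).1 (nat_of_ord (E i).2) e2 li ui lj uj => x y z.
  (* If u < v agree modulo T then u + T <= v, and 2^v (A - 3) exceeds 2^u (A' + 1): the range
     allowed to z by v starts beyond the one allowed by u. *)
  have key u v p q : (u < v)%N -> u = v %[mod T] -> (z + 1 <= 2 ^ u * (p + 1))%N ->
      (2 ^ v * q + 3 <= z + 2 ^ v * 3)%N -> (p <= A')%N -> (A <= q)%N -> False.
    move=> uv mod_uv hp hq pA Aq.
    have uTv : (u + T <= v)%N.
      have : (T %| v - u)%N by rewrite -(eqn_mod_dvd _ (ltnW uv)) mod_uv.
      by move/(dvdn_leq _); rewrite subn_gt0 => /(_ uv); rewrite leq_subRL// ltnW.
    have : (2 ^ (u + T) <= 2 ^ v)%N by rewrite leq_exp2l.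
    have h1 : (2 ^ v * (A - 3) <= z)%N.
      apply: (@leq_trans (2 ^ v * (q - 3))%N); first by rewrite leq_mul2l leq_sub2r ?orbT.
      by rewrite mulnBr leq_subLR; move: hq; clear; lia.
    have h2 : (2 ^ u * (p + 1) <= 2 ^ u * (A' + 1))%N by rewrite leq_mul2l leq_add2r pA orbT.
    have h3 : (2 ^ u * (A' + 1) < 2 ^ u * (2 ^ T * (A - 3)))%N.
      by rewrite ltn_mul2l expn_gt0.
    move=> h4; have {h4} : (2 ^ (u + T) * (A - 3) <= 2 ^ v * (A - 3))%N.
      by rewrite leq_mul2r h4 orbT.
    by rewrite expnD -mulnA; move: h1 h2 h3 hp; clear; lia.
  move=> xy li ui lj uj.
  have xyE : x = y.
    case: (ltngtP x y) => // [xy'|xy']; exfalso.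
      exact: (key x y i j).
    exact: (key y x j i).
  move: lj uj; rewrite -xyE => lj uj.
  (* With equal exponents the two starting indices differ by at most 4, so their residues modulo 5
     separate them. *)
  have dist p q : (2 ^ x * p + 3 <= z + 2 ^ x * 3)%N -> (z + 1 <= 2 ^ x * (q + 1))%N ->
      (p <= q + 4)%N.
    move=> hp hq; have : (2 ^ x * p <= 2 ^ x * (q + 4))%N by rewrite !mulnDr in hq *; move: hp hq; clear; lia.
    by rewrite leq_mul2l expn_eq0.
  have := dist _ _ li uj; have := dist _ _ lj ui.
  by move: e3; rewrite /=; clear; lia.
rewrite -(card_in_imset Finj).
have -> : (#|G| * (T * 5))%N = #|finset.setX G [set x : 'I_T * 'I_5 | true]|.
  by rewrite cardsX; congr (_ * _)%N; rewrite cardsE card_prod !card_ord.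
apply/subset_leq_card/fintype.subsetP => _ /imsetP[i iJ ->].
by rewrite !inE /= andbT; have [] := hE _ iJ; rewrite inE.
Qed.

(** Exponential moment bound with z = 2^-t: a residue counted here has weight 2^(t D) z^heavy at
    least 1, and [sum_heavy] bounds the total weight by 2^(t D) (1 + 1/16)^(8 t D), where (1 +
    1/16)^8 <= 2. *)
Lemma card_light t D k : (16 * b <= 2 ^ t)%N -> k = (8 * (t * D))%N ->
  (#|[set r : 'I_(b ^ k) | (heavy R b r k < D)%N]| <= 2 ^ (2 * (t * D)))%N.
Proof.
move=> bt ->; set k' := (8 * (t * D))%N.
rewrite -(@ler_nat R) -sum1_card natr_sum big_mkcond /=.
set z : R := (2 ^+ t)^-1.
have t0 : 0 < 2 ^+ t :> R by rewrite exprn_gt0.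
have z01 : 0 <= z <= 1.
  by rewrite invr_ge0 ltW//= invf_le1// exprn_ege1// ler1n.
apply: (@le_trans _ _ (\sum_(r < b ^ k') 2 ^+ (t * D) * z ^+ heavy R b r k')).
  apply: ler_sum => r _; rewrite inE.
  case: ifP => [h|_]; last by apply: mulr_ge0; apply: exprn_ge0 => //; case/andP: z01.
  rewrite exprM /z exprVn -ler_pdivrMr ?invr_gt0 ?exprn_gt0// invrK mul1r.
  by rewrite ler_weXn2l ?(ltnW h)// exprn_ege1// ler1n.
rewrite -mulr_sumr natrX (_ : 2 * (t * D) = t * D + t * D)%N; last by lia.
rewrite exprD ler_pM2l ?exprn_gt0//; apply: le_trans (sum_heavy b_ge2 _ z01) _.
have z16 : b%:R * z <= 16^-1.
  rewrite ler_pdivrMr// ler_pdivlMl// -natrM -natrX ler_nat//.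
have z0 : 0 <= b%:R * z by rewrite mulr_ge0 ?(ltW b0)//; case/andP: z01.
rewrite /k' exprM; apply: lerXn2r; rewrite ?nnegrE ?exprn_ge0 ?addr_ge0//.
apply: (@le_trans _ _ ((1 + 16^-1) ^+ 8)); last by lra.
by apply: lerXn2r; rewrite ?nnegrE; lra.
Qed.

(** [heavy] sees only residues modulo b^k, and those of the orbit are distinct. *)
Lemma card_light_orbit t D k q S1 N : (16 * b <= 2 ^ t)%N -> k = (8 * (t * D))%N ->
  (forall n1 n2, (n1 < n2 < N)%N -> q * S1 ^ n1 != q * S1 ^ n2 %[mod b ^ k])%N ->
  (#|[set n : 'I_N | (heavy R b (q * S1 ^ n) k < D)%N]| <= 2 ^ (2 * (t * D)))%N.
Proof.
move=> bt kE inj; apply: leq_trans (card_light bt kE).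
have bk0 : (0 < b ^ k)%N by rewrite expn_gt0; lia.
pose F (n : 'I_N) : 'I_(b ^ k) := Ordinal (ltn_pmod (q * S1 ^ n) bk0).
have Finj : injective F.
  move=> m n /(congr1 val)/= /eqP e; apply/val_inj => /=.
  case: (ltngtP m n) => // mn; first by move: (inj m n); rewrite mn ltn_ord e => /(_ isT).
  by move: (inj n m); rewrite mn ltn_ord eq_sym e => /(_ isT).
rewrite -(card_imset _ Finj); apply/subset_leq_card/fintype.subsetP.
by move=> _ /imsetP[n + ->]; rewrite !inE /= heavy_modl.
Qed.

End chain.

(** * Exponential sums *)

Section exponentials.
Variable R : realType.
Implicit Types x y : R.

Local Notation "2pi" := (pi *+ 2 : R).

(** The character exp(2 pi i x) of the reals modulo 1. *)
Definition cis x : R[i] := (cos (x * 2pi) +i* sin (x * 2pi))%C.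

Lemma normcD (z w : R[i]) : normc (z + w) <= normc z + normc w :> R.
Proof. exact: (@le_normcD R z w). Qed.

Lemma normc_ge0 (z : R[i]) : 0 <= normc z :> R.
Proof. by case: z => ? ?; exact: sqrtr_ge0. Qed.

Lemma normc_sum (I : Type) (s : seq I) (P : pred I) (F : I -> R[i]) :
  normc (\sum_(i <- s | P i) F i) <= \sum_(i <- s | P i) normc (F i).
Proof.
elim/big_ind2: _ => //; first by rewrite normc0.
by move=> z1 z2 w1 w2 h1 h2; apply: le_trans (normcD _ _) _; exact: lerD.
Qed.

Lemma normc_prod (I : Type) (s : seq I) (P : pred I) (F : I -> R[i]) :
  normc (\prod_(i <- s | P i) F i) = \prod_(i <- s | P i) normc (F i).
Proof. exact: (big_morph _ (@normcM R) (@normc1 R)). Qed.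

Lemma normc_sqr (z : R[i]) : normc z ^+ 2 = complex.Re z ^+ 2 + complex.Im z ^+ 2.
Proof. by case: z => u v; rewrite /= sqr_sqrtr// addr_ge0 ?sqr_ge0. Qed.

Lemma normc_Re_Im (z : R[i]) : normc z <= `|complex.Re z| + `|complex.Im z|.
Proof.
rewrite -(@ler_pXn2r _ 2)// ?nnegrE ?normc_ge0 ?addr_ge0//.
rewrite normc_sqr -(real_normK (num_real (complex.Re z))).
rewrite -(real_normK (num_real (complex.Im z))).
by have := normr_ge0 (complex.Re z); have := normr_ge0 (complex.Im z); nra.
Qed.

Lemma Re_le_normc (z : R[i]) : `|complex.Re z| <= normc z.
Proof.
rewrite -(@ler_pXn2r _ 2)// ?nnegrE ?normc_ge0//.
by rewrite normc_sqr real_normK ?num_real// lerDl sqr_ge0.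
Qed.

Lemma normc_cis x : normc (cis x) = 1.
Proof. by rewrite /= cos2Dsin2 sqrtr1. Qed.

Lemma cisD x y : cis (x + y) = cis x * cis y.
Proof.
rewrite /cis mulrDl sinD cosD; apply/eqP; rewrite eq_complex /=.
by rewrite eqxx addrC mulrC [X in _ + X]mulrC eqxx.
Qed.

Lemma cis0 : cis 0 = 1.
Proof. by rewrite /cis mul0r cos0 sin0. Qed.

Lemma cisMn x n : cis (n%:R * x) = cis x ^+ n.
Proof.
elim: n => [|n IH]; first by rewrite mul0r cis0 expr0.
by rewrite -natr1 mulrDl mul1r cisD IH exprSr.
Qed.

Lemma cis_int (k : int) : cis k%:~R = 1.
Proof.
have c1 : cis 1 = 1 by rewrite /cis mul1r cos2pi sin2pi.
have cn n : cis n%:R = 1 by rewrite -[n%:R]mulr1 cisMn c1 expr1n.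
case: k => n; first exact: cn.
rewrite NegzE mulrNz; have := cisD n.+1%:R (- n.+1%:R).
by rewrite subrr cis0 cn mul1r => <-.
Qed.

Lemma cisDint x (k : int) : cis (x + k%:~R) = cis x.
Proof. by rewrite cisD cis_int mulr1. Qed.

Lemma cisB x y : cis x - cis y = cis y * (cis (x - y) - 1).
Proof. by rewrite mulrBr mulr1 -cisD [y + _]addrC subrK. Qed.

Lemma lipschitz_derive (f df : R -> R) :
  (forall x, is_derive x 1 f (df x)) -> (forall x, `|df x| <= 1) ->
  forall x y, `|f x - f y| <= `|x - y|.
Proof.
move=> fd df1 x y; wlog xy : x y / y <= x.
  move=> wl; case/orP: (le_total y x) => [/wl//|/wl].
  by rewrite distrC [leRHS]distrC.
have [|c _ ->] := MVT_segment xy (fun z _ => fd z).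
  apply: continuous_subspaceT => z; apply: differentiable_continuous.
  by apply/derivable1_diffP; have := fd z; case.
by rewrite normrM -[leRHS]mul1r ler_wpM2r.
Qed.

Lemma sin_lipschitz x y : `|sin x - sin y| <= `|x - y|.
Proof. by apply: (@lipschitz_derive sin cos) => z; exact: cos_max. Qed.

Lemma cos_lipschitz x y : `|cos x - cos y| <= `|x - y|.
Proof.
apply: (@lipschitz_derive cos (fun z => - sin z)) => z.
by rewrite normrN; exact: sin_max.
Qed.

Lemma cis_nint_dist x (k := Num.floor (x + 2^-1)) : cis x = cis (x - k%:~R).
Proof. by rewrite -mulrNz cisDint. Qed.

Lemma normc_cis1 x : normc (cis x - 1) <= 2 * 2pi * nint_dist x.
Proof.
rewrite cis_nint_dist; apply: le_trans (normc_Re_Im _) _ => /=.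
have h : `|(x - (Num.floor (x + 2^-1))%:~R) * 2pi| = 2pi * nint_dist x.
  by rewrite normrM mulrC [`|2pi|]ger0_norm// mulrn_wge0// pi_ge0.
have := cos_lipschitz ((x - (Num.floor (x + 2^-1))%:~R) * 2pi) 0.
have := sin_lipschitz ((x - (Num.floor (x + 2^-1))%:~R) * 2pi) 0.
by rewrite cos0 sin0 !subr0 h; lra.
Qed.

Lemma normc_cisB x y : normc (cis x - cis y) <= 2 * 2pi * nint_dist (x - y).
Proof. by rewrite cisB normcM normc_cis mul1r normc_cis1. Qed.

Lemma cos_nint_dist x : cos (x * 2pi) = cos (nint_dist x * 2pi).
Proof.
rewrite -[LHS]/(complex.Re (cis x)) cis_nint_dist /= /nint_dist.
by case: ger0P => // _; rewrite mulNr cosN.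
Qed.

Lemma cos_nint_dist_le c x : 0 < c -> c <= nint_dist x -> cos (x * 2pi) <= cos (c * 2pi).
Proof.
move=> c0 cx; rewrite cos_nint_dist; have x2 := nint_dist_le_half x; have p0 := pi_gt0 R.
rewrite leNgt ltr_cos ?in_itv/=.
- by rewrite -leNgt ler_pM2r// mulrn_wgt0.
- by apply/andP; split; nra.
- by apply/andP; split; nra.
Qed.

Lemma cos_lt1 c : 0 < c -> c <= 2^-1 -> cos (c * 2pi) < 1.
Proof.
move=> c0 c2; have p0 := pi_gt0 R; rewrite -(cos0 R) ltr_cos ?in_itv/=.
- by rewrite mulr_gt0// mulrn_wgt0.
- by apply/andP; split; nra.
- by apply/andP; split; nra.
Qed.

Lemma normc_cis1_sqr x : normc (cis x - 1) ^+ 2 = 2 - 2 * cos (x * 2pi).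
Proof.
rewrite normc_sqr /= subr0; have := cos2Dsin2 (x * 2pi); nra.
Qed.

Lemma cis_neq1 x : 0 < nint_dist x -> cis x != 1.
Proof.
move=> x0; apply/eqP => e; have := normc_cis1_sqr x.
rewrite e subrr normc0 expr0n /=.
by have := cos_nint_dist_le x0 (lexx _); have := cos_lt1 x0 (nint_dist_le_half x); lra.
Qed.

Lemma sum_cis x Q : (cis x - 1) * \sum_(k < Q) cis (k%:R * x) = cis (Q%:R * x) - 1.
Proof.
by rewrite cisMn subrX1; congr (_ * _); apply: eq_bigr => k _; rewrite cisMn.
Qed.

Lemma sum_cis_eq0 (h Q : nat) : ~~ (Q %| h)%N -> (0 < Q)%N ->
  \sum_(k < Q) cis (k%:R * (h%:R / Q%:R)) = 0.
Proof.
move=> Qh Q0; have Q0' : 0 < Q%:R :> R by rewrite ltr0n.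
have := sum_cis (h%:R / Q%:R) Q; rewrite [Q%:R * _]mulrC divfK ?gt_eqF//.
rewrite (cis_int h : cis h%:R = 1) subrr.
move/eqP; rewrite mulf_eq0 => /orP[]; last by move/eqP.
rewrite subr_eq0; have : 0 < nint_dist (h%:R / Q%:R : R).
  rewrite lt_def nint_dist_ge0 andbT /nint_dist normr_eq0 subr_eq0; apply/negP => /eqP.
  set m := Num.floor _ => /(congr1 ( *%R^~ Q%:R)); rewrite divfK ?gt_eqF//.
  move=> e; have : (h%:Z = m * Q%:Z)%R.
    by apply: (@intr_inj R); rewrite intrM -!pmulrn.
  move: Qh => /negP Qh e'; apply: Qh; apply/dvdnP; exists `|m|%N.
  by move/(congr1 absz): e'; rewrite abszM.
by move/cis_neq1/negPf->.
Qed.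

(** * The characteristic function of one digit *)

Section digit_kernel.
Variable n : nat.

(** Modulus of the characteristic function of a uniform digit in {0, ..., n}; it is applied with n =
    b - 1. *)
Definition Phi x : R := normc (\sum_(d < n.+1) cis (d%:R * x)) / n.+1%:R.

Let n0 : 0 < n.+1%:R :> R. Proof. by rewrite ltr0n. Qed.

Lemma Phi_ge0 x : 0 <= Phi x. Proof. by rewrite divr_ge0 ?normc_ge0. Qed.

Lemma Phi_le1 x : Phi x <= 1.
Proof.
rewrite ler_pdivrMr// mul1r; apply: le_trans (normc_sum _ _ _) _.
by under eq_bigr do rewrite normc_cis; rewrite sumr_const card_ord.
Qed.

(** The geometric sum vanishes at h / (n + 1), and every term is Lipschitz in x modulo 1. *)
Lemma Phi_near x (h : nat) : ~~ (n.+1 %| h)%N ->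
  Phi x <= n.+1%:R * (2 * 2pi) * nint_dist (x - h%:R / n.+1%:R).
Proof.
move=> nh; rewrite ler_pdivrMr//.
have -> : \sum_(d < n.+1) cis (d%:R * x) = \sum_(d < n.+1)
    (cis (d%:R * x) - cis (d%:R * (h%:R / n.+1%:R))).
  by rewrite sumrB (sum_cis_eq0 nh) ?subr0.
apply: le_trans (normc_sum _ _ _) _.
set D := nint_dist _; apply: (@le_trans _ _ (\sum_(d < n.+1) n.+1%:R * (2 * 2pi) * D)).
  apply: ler_sum => d _; apply: le_trans (normc_cisB _ _) _.
  rewrite -mulrBr [n.+1%:R * _]mulrC -[leRHS]mulrA; apply: ler_wpM2l.
    by rewrite mulr_ge0// mulrn_wge0// pi_ge0.
  apply: le_trans (nint_dist_mulrn_le _ _) _; rewrite ler_wpM2r ?nint_dist_ge0// ler_nat.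
  exact/ltnW/ltn_ord.
by rewrite sumr_const card_ord mulr_natr.
Qed.

(** The first two terms, 1 and [cis x], already fail to align: their sum has modulus at most the
    square root of 2 + 2 cos(2 pi c), which is below 2. *)
Lemma Phi_gap c : (0 < n)%N -> 0 < c -> c <= 2^-1 ->
  exists2 w, 0 <= w < 1 & forall x, c <= nint_dist x -> Phi x <= w.
Proof.
move=> n1 c0 c2; have c1 := cos_lt1 c0 c2.
set s := Num.sqrt (2 + 2 * cos (c * 2pi)).
have s0 : 0 <= s by exact: sqrtr_ge0.
have s2 : s < 2.
  rewrite -(@ltr_pXn2r _ 2)// ?nnegrE// sqr_sqrtr; first by lra.
  by have := cos_geN1 (c * 2pi); lra.
exists ((s + n.-1%:R) / n.+1%:R).
  rewrite divr_ge0 ?addr_ge0//= ltr_pdivrMr// mul1r.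
  by have -> : n.+1%:R = 2 + n.-1%:R :> R; [rewrite -natrD; congr _%:R; lia|lra].
move=> x cx; rewrite ler_pM2r ?invr_gt0//; case: n n1 => // m _ /=.
rewrite !big_ord_recl /= addrA; apply: le_trans (normcD _ _) _; apply: lerD.
  rewrite mul0r mul1r cis0 -(@ler_pXn2r _ 2)// ?nnegrE ?normc_ge0//.
  rewrite normc_sqr sqr_sqrtr /=; last by have := cos_geN1 (c * 2pi); lra.
  by have := cos2Dsin2 (x * 2pi); have := cos_nint_dist_le c0 cx; nra.
apply: le_trans (normc_sum _ _ _) _.
by under eq_bigr do rewrite normc_cis; rewrite sumr_const card_ord.
Qed.

(** By independence the sum of exponentials over all words factors into one sum per letter; the
    cosine sum is its real part. *)
Lemma mean_cos_le M (th : 'I_M -> R) :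
  `|\sum_(w : {ffun 'I_M -> 'I_n.+1}) cos ((\sum_(k < M) (w k)%:R * th k) * 2pi)|
    / n.+1%:R ^+ M <= \prod_(k < M) Phi (th k).
Proof.
rewrite /Phi big_split /= prodfV prodr_const card_ord ler_pM2r ?invr_gt0 ?exprn_gt0//.
rewrite -normc_prod bigA_distr_bigA /=.
apply: le_trans (Re_le_normc _); rewrite le_eqVlt; apply/orP; left; apply/eqP; congr `|_|.
rewrite [RHS](raddf_sum (@complex.Re R : {additive R[i] -> R})).
apply: eq_bigr => w _; rewrite -[LHS]/(complex.Re (cis _)); congr complex.Re.
by rewrite (big_morph _ cisD cis0).
Qed.

End digit_kernel.
End exponentials.

Local Open Scope classical_set_scope.

(** * Fourier coefficients of Toeplitz numbers *)

Section odd_index.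
Local Open Scope nat_scope.

(** Zero-based index of the letter that [toeplitz] copies to the zero-based place i. *)
Definition odd_index (i : nat) : nat := ((i.+1)`_2^').+1./2.-1.

Lemma odd_part_odd n : odd (n`_2^').
Proof. by have := part_pnat 2^' n; rewrite p'natE// dvdn2 negbK. Qed.

Lemma odd_partM j e : odd j -> (j * 2 ^ e)`_2^' = j.
Proof.
move=> oj; have j0 : 0 < j by case: j oj.
rewrite partnM ?expn_gt0// part_pnat_id ?part_p'nat ?muln1//.
  by rewrite pnatNK pnatX pnat_id.
by rewrite p'natE// dvdn2 oj.
Qed.

Lemma odd_index_eq i k : (odd_index i == k) = ((i.+1)`_2^' == k.*2.+1).
Proof. by have := odd_part_odd i.+1; rewrite /odd_index; lia. Qed.

Lemma odd_index_lt M i : i < M -> odd_index i < M.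
Proof.
move=> iM; have : (i.+1)`_2^' <= i.+1 by rewrite dvdn_leq// dvdn_part.
by have := odd_part_odd i.+1; rewrite /odd_index; lia.
Qed.

(** Places up to M with odd part 2k + 1 are listed by their exponent of 2; exponents up to M suffice
    because e < 2^e. *)
Lemma perm_odd_index M k :
  perm_eq [seq k.*2.+1 * 2 ^ e | e <- iota 0 M.+1 & k.*2.+1 * 2 ^ e <= M]
          [seq i.+1 | i <- iota 0 M & odd_index i == k].
Proof.
apply: uniq_perm.
- rewrite map_inj_uniq ?filter_uniq ?iota_uniq// => e e' /eqP.
  by rewrite eqn_pmul2l// eqn_exp2l// => /eqP.
- by rewrite map_inj_uniq ?filter_uniq ?iota_uniq// => i i' [].
move=> x; apply/mapP/mapP => -[y]; rewrite mem_filter mem_iota add0n leq0n => /andP[h1 h2] ->.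
  have p0 : 0 < k.*2.+1 * 2 ^ y by rewrite muln_gt0 expn_gt0.
  exists (k.*2.+1 * 2 ^ y).-1; last by rewrite prednK.
  rewrite mem_filter mem_iota /= add0n odd_index_eq prednK// odd_partM ?eqxx//=.
  by rewrite odd_double.
move: h1; rewrite odd_index_eq => /eqP h1.
have yE : y.+1 = k.*2.+1 * 2 ^ logn 2 y.+1.
  by rewrite -h1 -p_part mulnC partnC.
exists (logn 2 y.+1); last exact: yE.
rewrite mem_filter mem_iota add0n leq0n -yE; apply/andP; split=> //=.
have : logn 2 y.+1 < 2 ^ logn 2 y.+1 by rewrite ltn_expl.
have : 2 ^ logn 2 y.+1 <= y.+1 by rewrite {2}yE leq_pmull.
lia.
Qed.

Lemma big_odd_index (R : nmodType) (F : nat -> R) M k :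
  (\sum_(e < M.+1 | (k.*2.+1 * 2 ^ e <= M)%N) F (k.*2.+1 * 2 ^ e)%N
    = \sum_(i < M | odd_index i == k) F i.+1)%R.
Proof.
rewrite -(big_mkord (fun e => k.*2.+1 * 2 ^ e <= M)%N (fun e => F (k.*2.+1 * 2 ^ e)%N)).
rewrite -(big_mkord (fun i => odd_index i == k) (fun i => F i.+1)).
rewrite /index_iota !subn0 -big_filter -[RHS]big_filter.
rewrite -(big_map (fun e => k.*2.+1 * 2 ^ e) xpredT F) -(big_map S xpredT F).
exact/perm_big/perm_odd_index.
Qed.

End odd_index.

(** * Truncated expansions and their Fourier coefficients *)

Section truncation.
Variables (R : realType) (b : nat).
Hypothesis b_ge2 : (2 <= b)%N.

Definition prefix_value M (t : nat -> alphabet b) : R :=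
  \sum_(1 <= j < M.+1) (t j.-1)%:R * b%:R ^- j.

Definition word_of M (a : nat -> alphabet b) : {ffun 'I_M -> alphabet b} :=
  [ffun i : 'I_M => a i].

(** The padding by 0 is harmless: the truncated sums below read only the first M letters. *)
Definition seq_of M (w : {ffun 'I_M -> alphabet b}) : oseq b :=
  fun i => if insub i is Some j then w j else ord0.

Lemma seq_ofE M (w : {ffun 'I_M -> alphabet b}) (i : 'I_M) : seq_of w i = w i.
Proof. by rewrite /seq_of valK. Qed.

Lemma prefix_value_word M (t : oseq b) :
  prefix_value M t = prefix_value M (seq_of (word_of M t)).
Proof.
apply: eq_big_nat => j /andP[j0 jM]; congr (_ * _); congr (_%:R).
have jM' : (j.-1 < M)%N by lia.
by rewrite -[j.-1]/(nat_of_ord (Ordinal jM')) seq_ofE ffunE.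
Qed.

Lemma toeplitzE (a : oseq b) i : toeplitz a i = a (odd_index i).
Proof. by []. Qed.

Lemma prefix_value_toeplitz M (a : oseq b) :
  prefix_value M (toeplitz a) = prefix_value M (toeplitz (seq_of (word_of M a))).
Proof.
apply: eq_big_nat => j /andP[j0 jM]; congr (_ * _); congr (_%:R).
have jM' : (odd_index j.-1 < M)%N by apply: odd_index_lt; lia.
by rewrite !toeplitzE -[odd_index _]/(nat_of_ord (Ordinal jM')) seq_ofE ffunE.
Qed.

(** Absolute value of the real part of the l-th Fourier coefficient of the truncated number, the
    first M letters being uniform. *)
Definition char_mean M (l : nat) : R :=
  `|\sum_(w : {ffun 'I_M -> alphabet b})
     cos (l%:R * prefix_value M (toeplitz (seq_of w)) * (pi *+ 2))| / b%:R ^+ M.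

Lemma toeplitz_sum_odd_index M l k : toeplitz_sum R b l M k.*2.+1
  = \sum_(i < M | odd_index i == k) l%:R / b%:R ^+ i.+1.
Proof. exact: (big_odd_index (fun i => l%:R / b%:R ^+ i)). Qed.

(** Grouping the places by odd part turns l times the truncated number into a sum over independent
    letters, to which [mean_cos_le] applies. *)
Lemma char_mean_prod M l :
  char_mean M l <= \prod_(k < M) Phi b.-1 (toeplitz_sum R b l M k.*2.+1).
Proof.
have bE : b = b.-1.+1 by lia.
rewrite /char_mean.
have -> : b%:R ^+ M = b.-1.+1%:R ^+ M :> R by rewrite -bE.
apply: le_trans (@mean_cos_le R b.-1 M (fun k => toeplitz_sum R b l M k.*2.+1)).
rewrite le_eqVlt; apply/orP; left; apply/eqP.
congr (`|_| / _); apply: eq_bigr => w _; congr (cos (_ * _)).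
rewrite /prefix_value big_add1 /= big_mkord mulr_sumr.
under [RHS]eq_bigr => k _.
  rewrite toeplitz_sum_odd_index mulr_sumr.
  over.
rewrite (partition_big (fun i : 'I_M => Ordinal (odd_index_lt (ltn_ord i))) xpredT)//=.
apply: eq_bigr => k _; apply: eq_big => [i|i /eqP ik]; first by rewrite -val_eqE.
rewrite toeplitzE -[odd_index i]/(nat_of_ord (Ordinal (odd_index_lt (ltn_ord i)))).
by rewrite ik seq_ofE mulrCA.
Qed.

Lemma char_mean_le1 M l : char_mean M l <= 1.
Proof.
apply: le_trans (char_mean_prod _ _) _.
by apply: prodr_ile1 => k _; rewrite Phi_ge0 Phi_le1.
Qed.

(** Each good odd index i = 2k + 1 owns the k-th factor of the product; the other factors are at
    most 1. *)
Lemma char_mean_card M l (c : R) : 0 <= c <= 1 ->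
  (forall i, good R b l M i -> Phi b.-1 (toeplitz_sum R b l M i) <= c) ->
  char_mean M l <= c ^+ #|[set i : 'I_M.+1 | odd i && good R b l M i]%SET|.
Proof.
move=> /andP[c0 c1] hc; apply: le_trans (char_mean_prod _ _) _.
set G := [set i | _]%SET.
apply: (@le_trans _ _ (\prod_(k < M | good R b l M k.*2.+1) c)).
  rewrite [leRHS]big_mkcond /=; apply: ler_prod => k _.
  by rewrite Phi_ge0 /=; case: ifP => [/hc|]//; rewrite Phi_le1.
rewrite prodr_const ler_wiXn2l//.
have [M0|M0] := posnP M.
  rewrite (_ : #|G| = 0%N)//; apply: eq_card0 => i; rewrite !inE.
  have -> // : (i : nat) = 0%N by have := ltn_ord i; lia.
pose F (i : 'I_M.+1) : 'I_M := insubd (Ordinal M0) (i./2).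
have FE (i : 'I_M.+1) : i \in G -> F i = i./2 :> nat.
  rewrite inE => /andP[oi _]; rewrite /F val_insubd.
  have := ltn_ord i; move: oi; case: (ltnP i./2 M); lia.
have Finj : {in G &, injective F}.
  move=> i j iG jG /(congr1 val) /=; rewrite !FE// => ij; apply/val_inj => /=.
  by move: iG jG; rewrite !inE => /andP[oi _] /andP[oj _]; lia.
rewrite -(card_in_imset Finj); apply/subset_leq_card/fintype.subsetP.
move=> _ /imsetP[i iG ->]; rewrite unfold_in /= FE//.
move: iG; rewrite inE => /andP[oi gi].
by rewrite (_ : (i./2).*2.+1 = i)//; lia.
Qed.

Lemma char_mean_single M l j : odd j -> (j <= M)%N ->
  char_mean M l <= Phi b.-1 (toeplitz_sum R b l M j).
Proof.
move=> oj jM; apply: le_trans (char_mean_prod _ _) _.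
have jM' : (j./2 < M)%N by lia.
rewrite (bigD1 (Ordinal jM'))//= (_ : (j./2).*2.+1 = j); last by lia.
rewrite ler_piMr ?Phi_ge0//.
by apply: prodr_ile1 => k _; rewrite Phi_ge0 Phi_le1.
Qed.

End truncation.

(** Pairs are sorted by g = m - n; the condition n + g < N is then dropped, which only adds
    nonnegative terms. *)
Lemma sum_gap (R : realType) N (F : nat -> nat -> R) : (forall m n, 0 <= F m n) ->
  \sum_(m < N) \sum_(n < N | (n < m)%N) F m n <=
  \sum_(1 <= g < N) \sum_(n < N) F (n + g)%N n.
Proof.
move=> F0; rewrite (exchange_big_dep xpredT)//= [leRHS]exchange_big /=.
apply: ler_sum => n _.
rewrite -(big_mkord (fun m => n < m)%N (fun m => F m n)).
rewrite (@big_cat_nat _ _ _ n.+1)//= ?ltn_ord//.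
rewrite big_nat_cond big_pred0 ?add0r; last by move=> i; lia.
rewrite big_nat_cond (eq_bigl (fun m => (n.+1 <= m < N)%N)); last by move=> i; lia.
rewrite -big_nat -{1}[n.+1]add1n big_addn.
rewrite [leRHS](@big_cat_nat _ _ _ (N - n))//=; try by have := ltn_ord n; lia.
rewrite (eq_bigr (fun g => F (n + g)%N n)); last by move=> g _; rewrite addnC.
by rewrite lerDl sumr_ge0.
Qed.

(** * The second moment of the exponential sums *)

Section energy.
Variables (R : realType) (b : nat).
Hypothesis b_ge2 : (2 <= b)%N.

Let b0 : 0 < b%:R :> R. Proof. by rewrite ltr0n; lia. Qed.

Lemma dshift_shift x a i : dshift R b (x * b ^ a) (a + i) = dshift R b x i.
Proof.
rewrite /dshift natrM natrX exprD; congr nint_dist.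
by field; rewrite !expf_neq0 ?gt_eqF.
Qed.

Lemma heavy_card x k : heavy R b x k =
  #|[set i : 'I_k.+1 | (0 < i)%N && ((2 * b%:R)^-1 <= dshift R b x i)%R]%SET|.
Proof.
rewrite /heavy -sum1_card big_add1 /= big_mkord [RHS]big_mkcond big_ord_recl /= inE /=.
by rewrite add0n; apply: eq_bigr => i _; rewrite inE /= /bump leq0n add1n; case: (_ <= _).
Qed.

(** Multiplication by b^a shifts positions by a. Each position then moves to a + i or a + i + 1,
    whichever is odd, so an image is shared by at most two; dropping the i < u costs at most u. *)
Lemma card_odd_heavy x a k u D : (D <= heavy R b x k)%N ->
  (D - u <= 2 * #|[set i : 'I_(a + k + 1).+1 | [&& odd i, (a + u <= i)%N &
     ((2 * b%:R ^+ 2)^-1 <= dshift R b (x * b ^ a) i)%R]]%SET|)%N.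
Proof.
rewrite heavy_card; set H := [set i | _]%SET; set J := [set i | _]%SET => DH.
pose H' := [set i in H | (u <= i)%N]%SET.
have DH' : (D - u <= #|H'|)%N.
  rewrite leq_subLR; apply: leq_trans DH _.
  have sub : H \subset [set i : 'I_k.+1 | (0 < i < u)%N]%SET :|: H'.
    apply/fintype.subsetP => i; rewrite !inE => /andP[-> ->] /=.
    by case: ltnP.
  apply: leq_trans (subset_leq_card sub) _; apply: leq_trans (leq_card_setU _ _) _.
  rewrite leq_add2r; case: u {H' J sub} => [|u]; first by rewrite eq_card0// => i; rewrite !inE; lia.
  pose F (i : 'I_k.+1) : 'I_u.+1 := inord i.
  have Finj : {in [set i : 'I_k.+1 | (0 < i < u.+1)%N]%SET &, injective F}.
    move=> i j; rewrite !inE => /andP[_ iu] /andP[_ ju] /(congr1 val) /=.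
    by rewrite !inordK// => /val_inj.
  by rewrite -(card_in_imset Finj) -[X in (_ <= X)%N]card_ord max_card.
apply: leq_trans DH' _.
have /choice[E hE] (i : 'I_k.+1) : exists i' : 'I_(a + k + 1).+1, i \in H' ->
    i' \in J /\ (a + i <= i' <= a + i.+1)%N.
  have [|_] := boolP (i \in H'); last by exists ord0.
  rewrite !inE => /andP[/andP[i0 hi] ui].
  have := @odd_heavy R b b_ge2 (x * b ^ a) (a + i); rewrite dshift_shift => /(_ hi).
  move=> [i' oi' [ii' hi']]; have iak : (i' < (a + k + 1).+1)%N by have := ltn_ord i; lia.
  exists (Ordinal iak) => _; rewrite !inE /= oi' hi' andbT; split; lia.
pose F (i : 'I_k.+1) := (E i, E i == (a + i)%N :> nat).
have Finj : {in H' &, injective F}.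
  move=> i j iH jH [e1 e2]; apply/val_inj => /=.
  have [_ h1] := hE _ iH; have [_ h2] := hE _ jH; rewrite -e1 in h2 e2.
  by move: e2; case: eqP; case: eqP => // *; lia.
rewrite -(card_in_imset Finj) mulnC.
have -> : (#|J| * 2)%N = #|finset.setX J [set x : bool | true]%SET|.
  by rewrite cardsX; congr (_ * _)%N; rewrite cardsE card_bool.
apply/subset_leq_card/fintype.subsetP => _ /imsetP[i iH ->].
by have [iJ _] := hE _ iH; apply/finset.setXP; split.
Qed.

(** Put D0 = 5 T D1. Of 4 D0 heavy positions at least 2 D0 remain from index 2 D0 on, giving D0 odd
    ones; a good index is shared by at most 5 T of these, which leaves D1 good indices. T = 32 t + 2
    is large enough for the range condition of [card_good]. *)
Lemma char_mean_heavy t T D1 x a M (w : R) : T = (32 * t + 2)%N -> (0 < D1)%N ->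
  0 <= w <= 1 -> (forall y, (2 * b%:R ^+ 2)^-1 / 2 <= nint_dist y -> Phi b.-1 y <= w) ->
  (2 * b ^ 2 * (x * b ^ a) < b ^ M)%N ->
  (20 * T * D1 <= heavy R b x (8 * (t * (20 * T * D1))))%N ->
  char_mean R b M (x * b ^ a) <= w ^+ D1.
Proof.
move=> TE D10 w01 hw lM; set D0 := (5 * T * D1)%N => hH.
have T0 : (0 < T)%N by lia.
have D03 : (3 <= D0)%N by rewrite /D0; nia.
have DE : (20 * T * D1 = 4 * D0)%N by rewrite /D0; ring.
apply: le_trans (char_mean_card b_ge2 w01 _) _; first by move=> i; exact: hw.
case/andP: (w01) => w0 w1; apply: ler_wiXn2l => //.
have := card_odd_heavy a (2 * D0) hH; rewrite DE.
set k := (8 * (t * (4 * D0)))%N.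
have AT : ((a + k + 1) + 1 < 2 ^ T * (a + 2 * D0 - 3))%N.
  have T2 : (T < 2 ^ T)%N by rewrite ltn_expl.
  have h1 : (T.+1 * (a + D0) <= 2 ^ T * (a + 2 * D0 - 3))%N by apply: leq_mul => //; lia.
  apply: leq_trans h1; rewrite /k TE; move: D03; clear; nia.
have := @card_good R b b_ge2 _ _ _ _ _ T0 lM _ AT; have -> : (3 < a + 2 * D0)%N by lia.
move=> /(_ isT) h1 h2.
rewrite -(@leq_pmul2r (T * 5)); last by lia.
apply: leq_trans h1; rewrite (_ : D1 * (T * 5) = D0)%N; last by rewrite /D0; ring.
by rewrite -(@leq_pmul2l 2)//; apply: leq_trans h2; lia.
Qed.

Variables (S h : nat).

(** This is h |S^m - S^n|: one of the two truncated subtractions is zero. *)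
Definition freq_diff m n := (h * ((S ^ m - S ^ n) + (S ^ n - S ^ m)))%N.

(** Bounds the mean, over uniform words of length M, of the squared modulus of the exponential
    sum. *)
Definition energy N M : R :=
  \sum_(m < N) \sum_(n < N) char_mean R b M (freq_diff m n).

Lemma freq_diffC m n : freq_diff m n = freq_diff n m.
Proof. by rewrite /freq_diff addnC. Qed.

Lemma char_mean_ge0 M l : 0 <= char_mean R b M l.
Proof. by rewrite divr_ge0// exprn_ge0// ltW. Qed.

Lemma energy_le N M : energy N M <=
  N%:R + 2 * \sum_(m < N) \sum_(n < N | (n < m)%N) char_mean R b M (freq_diff m n).
Proof.
rewrite /energy; set F := fun m n => char_mean R b M (freq_diff m n).
have -> : \sum_(m < N) \sum_(n < N) char_mean R b M (freq_diff m n)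
    = \sum_(m < N) F m m + \sum_(m < N) \sum_(n < N | (n < m)%N) F m n
      + \sum_(m < N) \sum_(n < N | (m < n)%N) F m n.
  rewrite -!big_split /=; apply: eq_bigr => m _.
  rewrite (bigID (fun n : 'I_N => (n < m)%N)) /= addrC (bigD1 m) ?ltnn//=.
  rewrite addrAC -/(F m m); congr (_ + _ + _); apply: eq_bigl => n.
  by rewrite -leqNgt ltn_neqAle eq_sym andbC -val_eqE.
rewrite [X in _ + X <= _](exchange_big_dep xpredT) //=.
rewrite [X in _ + X <= _](_ : _ = \sum_(m < N) \sum_(n < N | (n < m)%N) F m n); last first.
  by apply: eq_bigr => m _; apply: eq_bigr => n _; rewrite /F freq_diffC.
have : \sum_(m < N) F m m <= N%:R.
  apply: (@le_trans _ _ (\sum_(m < N) 1)); last by rewrite sumr_const card_ord.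
  by apply: ler_sum => m _; exact: char_mean_le1.
rewrite /F; lra.
Qed.

End energy.

Lemma bernoulli_subX (R : realType) (x : R) k : 0 <= x <= 1 -> 1 - k%:R * x <= (1 - x) ^+ k.
Proof.
move=> /andP[x0 x1]; elim: k => [|k IH]; first by rewrite mul0r subr0 expr0.
rewrite exprSr; have kx : 0 <= k%:R * x by rewrite mulr_ge0.
apply: le_trans (ler_wpM2r _ IH); last by rewrite subr_ge0.
rewrite -natr1; nra.
Qed.

(** Turns a decay v per k steps into a decay g per step; by Bernoulli's inequality g = 1 - (1 - v) /
    k will do. *)
Lemma exists_root_bound (R : realType) (v : R) k : 0 <= v < 1 -> (0 < k)%N ->
  exists2 g : R, 0 <= g < 1 & v <= g ^+ k.
Proof.
move=> /andP[v0 v1] k0; have k0' : 0 < k%:R :> R by rewrite ltr0n.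
have k1 : 1 <= k%:R :> R by rewrite ler1n.
have x1 : (1 - v) / k%:R <= 1 by rewrite ler_pdivrMr//; lra.
have x0 : 0 < (1 - v) / k%:R by rewrite divr_gt0//; lra.
exists (1 - (1 - v) / k%:R); first by apply/andP; split; lra.
apply: le_trans (bernoulli_subX _ _); last by rewrite x1 ltW.
by rewrite mulrC divfK ?gt_eqF//; lra.
Qed.

(** * Second moment when S has a cofactor S1 > 1 *)

Section independent_energy.
Variables (R : realType) (b : nat).
Hypothesis b_ge2 : (2 <= b)%N.

Let b0 : 0 < b%:R :> R. Proof. by rewrite ltr0n; lia. Qed.

(** For each gap q, at most B of the n give a frequency with fewer than D heavy positions, and every
    other n contributes at most w^D1. Here D1 is proportional to L and B is of order at most the
    square root of N. *)
Lemma energy_independent p r S1 S h : prime p -> (p %| b)%N ->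
  S1 = 1 %[mod p ^ 2] -> (1 < S1)%N -> S = (b ^ r * S1)%N -> (0 < h)%N ->
  exists C g : R, [/\ 0 <= C, 0 <= g < 1 & forall L N M,
    (2 ^ L <= N < 2 ^ L.+1)%N -> (2 * b ^ 2 * (h * S ^ (2 * N)) < b ^ M)%N ->
    energy R b S h N M <= C * g ^+ L * N%:R ^+ 2].
Proof.
move=> pp pb S11 S1gt SE h0.
have S0 : (0 < S)%N by rewrite SE muln_gt0 expn_gt0 (ltnW b_ge2) (ltnW S1gt).
have [t bt t0] : exists2 t, (16 * b <= 2 ^ t)%N & (0 < t)%N.
  by exists (16 * b)%N; [rewrite ltnW// ltn_expl|lia].
have [T TE] : exists T, T = (32 * t + 2)%N by exists (32 * t + 2)%N.
have T0 : (0 < T)%N by lia.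
have bp0 : 0 < 2 * b%:R ^+ 2 :> R by rewrite mulr_gt0 ?exprn_gt0.
have bp1 : 1 <= 2 * b%:R ^+ 2 :> R.
  by rewrite -natrX -natrM ler1n muln_gt0 expn_gt0; lia.
have [||| w w01 hw] := @Phi_gap R b.-1 ((2 * b%:R ^+ 2)^-1 / 2).
- by lia.
- by rewrite divr_gt0 ?invr_gt0.
- by rewrite ler_pdivrMr// mulVf// invf_le1.
(* Below, B^2 = 2^(K2 D1) and 2^k = 2^(2 K2 D1), so K2 D1 close to L gives both B^2 = O(N) and 2^k >
   h S1^2 N^2. *)
have [K2 K2E] : exists K2, K2 = (80 * t * T)%N by exists (80 * t * T)%N.
have K20 : (0 < K2)%N by rewrite K2E !muln_gt0 t0 T0.
have [c cE] : exists c, c = (h * S1 ^ 2 * 4)%N by exists (h * S1 ^ 2 * 4)%N.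
pose K : R := 2 ^+ (K2 * (c + 2)).
(* The maximum dominates both rates that occur, w from the heavy terms and 1/2 from the count B. *)
pose v := Num.max w 2^-1.
have v01 : 0 <= v < 1 by rewrite /v le_max gt_max; case/andP: w01 => -> ->/=; lra.
have [g g01 vg] := exists_root_bound v01 K20.
have K0 : 0 <= K by rewrite exprn_ge0.
exists (3 * K + 2), g; split=> //; first by lra.
move=> L N M /andP[LN NL] hM.
(* The summand c + 2 lifts K2 D1 above L + c, where 2^c > 4 h S1^2 absorbs the constants; the excess
   over L stays bounded. *)
have [D1 D1E] : exists D1, D1 = (L %/ K2 + (c + 2))%N by exists (L %/ K2 + (c + 2))%N.
have [B BE] : exists B, B = (2 ^ (40 * t * T * D1))%N by exists (2 ^ (40 * t * T * D1))%N.
have [D DE] : exists D, D = (20 * T * D1)%N by exists (20 * T * D1)%N.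
have [k kE] : exists k, k = (8 * (t * D))%N by exists (8 * (t * D))%N.
have KD1 : (L + (c + 1) <= K2 * D1)%N.
  have h1 := ltn_ceil L K20; rewrite mulSn in h1.
  have -> : (K2 * D1 = L %/ K2 * K2 + (c + 2) * K2)%N by rewrite D1E; ring.
  have : ((c + 1) + K2 <= (c + 2) * K2)%N by move: K20; clear; nia.
  by move: h1; clear; lia.
have KD2 : (K2 * D1 <= L + K2 * (c + 2))%N.
  by rewrite D1E mulnDr leq_add2r mulnC leq_trunc_div.
have N0 : 0 < N%:R :> R by rewrite ltr0n; apply: leq_trans LN; rewrite expn_gt0.
have B1 : 1 <= B%:R :> R by rewrite ler1n BE expn_gt0.
(* Follows from B^2 <= N K and 2^D1 <= B. *)
have BN : B%:R <= N%:R * K * (2^-1) ^+ D1.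
  have BB : (B * B <= N * 2 ^ (K2 * (c + 2)))%N.
    apply: (@leq_trans (2 ^ L * 2 ^ (K2 * (c + 2)))); last by rewrite leq_mul2r LN orbT.
    rewrite BE -!expnD leq_exp2l// (_ : (_ + _)%N = K2 * D1)%N//.
    by rewrite K2E; ring.
  have BD : 2 ^+ D1 <= B%:R :> R.
    rewrite BE natrX; apply: ler_weXn2l; first by rewrite ler1n.
    by rewrite leq_pmull// !muln_gt0 t0 T0.
  rewrite exprVn ler_pdivlMr ?exprn_gt0//.
  apply: (@le_trans _ _ (B%:R * B%:R)); first by rewrite ler_wpM2l.
  by rewrite /K -natrX -!natrM ler_nat.
have hk : (h * S1 ^ 2 * N ^ 2 < 2 ^ k)%N.
  have c2 : (h * S1 ^ 2 * 4 < 2 ^ c)%N by rewrite -cE ltn_expl.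
  have k2E : (k = 2 * (K2 * D1))%N by rewrite kE DE K2E; ring.
  have N2 : (N ^ 2 <= 4 * 2 ^ (2 * L))%N.
    have -> : (4 * 2 ^ (2 * L) = (2 ^ L.+1) ^ 2)%N.
      by rewrite -expnM -(expnD 2 2); congr (_ ^ _)%N; clear; lia.
    by rewrite leq_exp2r// ltnW.
  apply: (@leq_trans (2 ^ (c + 2 * L))); last first.
    by rewrite k2E leq_exp2l//; move: KD1; clear; lia.
  apply: (@leq_ltn_trans (h * S1 ^ 2 * (4 * 2 ^ (2 * L)))); first by rewrite leq_mul2l N2 orbT.
  by rewrite mulnA expnD ltn_pmul2r ?expn_gt0.
(* The frequency is [x n] times b^(r n), and this power of b only shifts the positions. *)
have gap q : (0 < q < N)%N ->
    \sum_(n < N) char_mean R b M (freq_diff S h (n + q) n) <= B%:R + N%:R * w ^+ D1.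
  move=> /andP[q0 qN]; pose x n := (h * (S ^ q - 1) * S1 ^ n)%N.
  have fE n : freq_diff S h (n + q) n = (x n * b ^ (r * n))%N.
    have le_q : (S ^ n <= S ^ n * S ^ q)%N by apply: leq_pmulr; rewrite expn_gt0 S0.
    have eq_q : (S ^ n * S ^ q - S ^ n = S ^ n * (S ^ q - 1))%N by rewrite mulnBr muln1.
    move: le_q; rewrite -subn_eq0 => /eqP le_q; rewrite /freq_diff expnD le_q addn0 eq_q /x.
    rewrite (_ : S ^ n = b ^ (r * n) * S1 ^ n)%N; last by rewrite SE expnMn -expnM.
    move: (S ^ q - 1)%N (b ^ (r * n))%N (S1 ^ n)%N.
    by clear => *; ring.
  have w0 : 0 <= w by case/andP: w01.
  rewrite (bigID (fun n : 'I_N => heavy R b (x n) k < D)%N) /=.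
  apply: lerD.
    apply: (@le_trans _ _ (\sum_(n < N | (heavy R b (x n) k < D)%N) 1)).
      by apply: ler_sum => n _; exact: char_mean_le1.
    rewrite sumr_const ler_nat.
    have := @card_light_orbit R b b_ge2 t D k (h * (S ^ q - 1)) S1 N bt kE.
    rewrite BE cardsE (_ : 2 * (t * D) = 40 * t * T * D1)%N; last by rewrite DE; ring.
    apply=> n1 n2 n12; apply: (expn_mod_inj pp _ pb S11 S1gt SE h0 _ n12 hk); first exact: ltnW.
    by rewrite q0.
  apply: (@le_trans _ _ (\sum_(n < N) w ^+ D1)); last first.
    by rewrite sumr_const card_ord -[_ *+ _]mulr_natl.
  rewrite [leLHS]big_mkcond; apply: ler_sum => n _; case: ifP => [|_]; last exact: exprn_ge0.
  rewrite -leqNgt => hx; rewrite fE; rewrite kE DE in hx.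
  apply: (@char_mean_heavy _ _ b_ge2 t T) => //.
  - by rewrite D1E addn2 addnS.
  - by rewrite w0 ltW//; case/andP: w01.
  - rewrite -fE; apply: leq_ltn_trans hM; rewrite leq_mul2l; apply/orP; right.
    rewrite /freq_diff leq_mul2l; apply/orP; right.
    apply: (@leq_trans (S ^ (n + q))%N).
      have : (S ^ n <= S ^ (n + q))%N by rewrite expnD leq_pmulr// expn_gt0 S0.
      by clear; lia.
    by rewrite leq_pexp2l//; have := ltn_ord n; move: qN; clear; lia.
apply: le_trans (@energy_le R b b_ge2 S h N M) _.
have := sum_gap N (fun m n => @char_mean_ge0 R b M (freq_diff S h m n)).
set E := \sum_(m < N) _ => hE.
have {}hE : E <= N%:R * (B%:R + N%:R * w ^+ D1).
  apply: le_trans hE _; apply: (@le_trans _ _ (\sum_(1 <= q < N) (B%:R + N%:R * w ^+ D1))).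
    by rewrite big_nat_cond [leRHS]big_nat_cond; apply: ler_sum => q /andP[qN _]; exact: gap.
  rewrite sumr_const_nat -[_ *+ (N - 1)]mulr_natl ler_wpM2r ?ler_nat ?leq_subr//.
  by rewrite addr_ge0// mulr_ge0// exprn_ge0//; case/andP: w01.
have v0 : 0 <= v by case/andP: v01.
have wv : w ^+ D1 <= v ^+ D1.
  by apply: lerXn2r; rewrite ?nnegrE//; [case/andP: w01|rewrite /v le_max lexx].
have hv : (2^-1) ^+ D1 <= v ^+ D1.
  by apply: lerXn2r; rewrite ?nnegrE// /v le_max lexx orbT.
have vgL : v ^+ D1 <= g ^+ L.
  case/andP: g01 => g0 g1.
  apply: (@le_trans _ _ ((g ^+ K2) ^+ D1)); first by apply: lerXn2r; rewrite ?nnegrE ?exprn_ge0.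
  by rewrite -exprM; apply: ler_wiXn2l => //; [exact: ltW|move: KD1; clear; lia].
apply: (@le_trans _ _ ((3 * K + 2) * v ^+ D1 * N%:R ^+ 2)); last first.
  by rewrite ler_wpM2r ?exprn_ge0// ler_wpM2l//; lra.
have BN' : B%:R <= N%:R * K * v ^+ D1 by apply: le_trans BN _; rewrite ler_wpM2l// mulr_ge0// ltW.
have e1 : N%:R <= N%:R * B%:R :> R by rewrite ler_peMr// ltW.
have e2 : N%:R * B%:R <= N%:R * (N%:R * K * v ^+ D1) by rewrite ler_wpM2l// ltW.
have e3 : N%:R * (N%:R * w ^+ D1) <= N%:R * (N%:R * v ^+ D1) by rewrite !ler_wpM2l// ltW.
rewrite mulrDr in hE.
rewrite (_ : (3 * K + 2) * _ * _ = 3 * (N%:R * (N%:R * K * v ^+ D1))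
  + 2 * (N%:R * (N%:R * v ^+ D1))); last by ring.
lra.
Qed.

End independent_energy.

Lemma exists_base_cofactor b h : (1 < b)%N -> (0 < h)%N ->
  exists v h', h = (b ^ v * h')%N /\ ~~ (b %| h')%N.
Proof.
move=> b1; elim/ltn_ind: h => h IH h0.
have [/dvdnP[q qE]|] := boolP (b %| h)%N; last by exists 0%N, h; rewrite mul1n.
have q0 : (0 < q)%N by case: q qE h0 => // ->.
have [|//|v [h' [hE nb]]] := IH q; first by rewrite qE ltn_Pmulr.
by exists v.+1, h'; rewrite qE hE expnS mulnC mulnA.
Qed.

Lemma card_window N r v x W : (0 < r)%N ->
  (#|[set n : 'I_N | (r * n + v < x <= r * n + v + W)%N]%SET| <= W)%N.
Proof.
move=> r0; case: W => [|W]; first by rewrite eq_card0// => n; rewrite !inE; lia.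
pose F (n : 'I_N) : 'I_W.+1 := inord (x - (r * n + v)).-1.
have Finj : {in [set n : 'I_N | (r * n + v < x <= r * n + v + W.+1)%N]%SET &, injective F}.
  move=> n1 n2; rewrite !inE => h1 h2 /(congr1 val); rewrite /= !inordK; try lia.
  move=> h; apply/val_inj => /=; apply/eqP; rewrite -(eqn_pmul2l r0); apply/eqP; lia.
by rewrite -(card_in_imset Finj) -[X in (_ <= X)%N]card_ord max_card.
Qed.

(** * Second moment when S is a power of b *)

Section dependent_energy.
Variables (R : realType) (b : nat).
Hypothesis b_ge2 : (2 <= b)%N.

Let b0 : 0 < b%:R :> R. Proof. by rewrite ltr0n; lia. Qed.
Let b1 : 1 <= b%:R :> R. Proof. by rewrite ler1n; lia. Qed.

Lemma nint_dist_pow h a i W : (i <= a)%N \/ (a + W <= i)%N ->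
  nint_dist (h%:R * b%:R ^+ a / b%:R ^+ i) <= h%:R / b%:R ^+ W :> R.
Proof.
have p0 k : 0 < b%:R ^+ k :> R by exact: exprn_gt0.
case=> [ia|ai].
  have -> : h%:R * b%:R ^+ a / b%:R ^+ i = ((h * b ^ (a - i))%N%:Z)%:~R :> R.
    rewrite -[RHS]/((_ * _)%N%:R) natrM natrX -{1}(subnK ia) exprD.
    by field; rewrite !gt_eqF.
  by rewrite nint_dist_int divr_ge0// ltW.
apply: le_trans (nint_dist_le_norm _) _; rewrite ger0_norm; last first.
  by rewrite divr_ge0 ?mulr_ge0// ltW.
rewrite -mulrA ler_wpM2l// ler_pdivrMr// mulrC ler_pdivlMr// -exprD.
exact: ler_weXn2l.
Qed.

(** A single factor suffices, at the odd part j of m + 1. The place j 2^e = m + 1 contributes h / b,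
    a zero of the characteristic function; all other contributions of b^m and of b^n are within h
    b^-W of integers, as no place j 2^e' lies in the window after n. *)
Lemma char_mean_dependent h m n W e j M : ~~ (b %| h)%N -> (n < m)%N ->
  m.+1 = (j * 2 ^ e)%N -> odd j -> (m < M)%N -> (W <= m)%N ->
  (forall e', (e' <= e)%N -> ~~ (n < j * 2 ^ e' <= n + W)%N) ->
  char_mean R b M (h * (b ^ m - b ^ n)) <=
    b%:R * (2 * (pi *+ 2)) * (M.+1%:R * (2 * h%:R)) / b%:R ^+ W.
Proof.
move=> bh nm mE oj mM Wm no.
have j0 : (0 < j)%N by case: j oj {mE no}.
have jm : (j <= m.+1)%N by rewrite mE leq_pmulr// expn_gt0.
apply: le_trans (@char_mean_single R b b_ge2 M _ j oj (leq_trans jm mM)) _.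
have bh' : ~~ (b.-1.+1 %| h)%N by rewrite prednK// ltnW.
apply: le_trans (Phi_near _ bh') _; rewrite prednK ?(ltnW b_ge2)//.
rewrite -[leRHS]mulrA; apply: ler_wpM2l.
  by rewrite mulr_ge0 ?(ltW b0)// mulr_ge0// mulrn_wge0// pi_ge0.
have eM : (e < M.+1)%N.
  have : (e < 2 ^ e)%N by rewrite ltn_expl.
  have : (2 ^ e <= m.+1)%N by rewrite mE leq_pmull.
  by move: mM; clear; lia.
have -> : toeplitz_sum R b (h * (b ^ m - b ^ n)) M j - h%:R / b%:R =
    \sum_(e' < M.+1 | (j * 2 ^ e' <= M)%N)
      ((h%:R * b%:R ^+ m / b%:R ^+ (j * 2 ^ e') - (e' == e :> nat)%:R * (h%:R / b%:R))
       - h%:R * b%:R ^+ n / b%:R ^+ (j * 2 ^ e')).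
  transitivity (toeplitz_sum R b (h * (b ^ m - b ^ n)) M j -
      \sum_(e' < M.+1 | (j * 2 ^ e' <= M)%N) (e' == e :> nat)%:R * (h%:R / b%:R)).
    congr (_ - _); rewrite (bigD1 (Ordinal eM)) /=; last by rewrite -mE.
    rewrite eqxx mul1r big1 ?addr0// => e' /andP[_]; rewrite -val_eqE /= => /negPf->.
    by rewrite mul0r.
  rewrite -sumrB; apply: eq_bigr => e' _.
  rewrite natrM natrB ?natrX; last by rewrite leq_exp2l// ltnW.
  by rewrite mulrBr mulrBl; ring.
apply: le_trans (nint_dist_sum _ _ _) _; rewrite big_mkcond /=.
apply: (@le_trans _ _ (\sum_(e' < M.+1) (2 * h%:R / b%:R ^+ W))); last first.
  by rewrite sumr_const card_ord -[_ *+ _]mulr_natl mulrA.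
apply: ler_sum => e' _; case: ifP => [_|_]; last first.
  by rewrite divr_ge0 ?mulr_ge0// exprn_ge0// ltW.
(* The next doubling of m + 1 is already beyond m + W, because W <= m. *)
have far : (e < e')%N -> (m + W < j * 2 ^ e')%N.
  move=> ee'; have : (j * 2 ^ e.+1 <= j * 2 ^ e')%N by rewrite leq_mul2l leq_exp2l// ee' orbT.
  by rewrite expnS mulnCA -mE; move: Wm; clear; lia.
apply: le_trans (nint_distD _ _) _; rewrite nint_distN.
have -> : 2 * h%:R / b%:R ^+ W = h%:R / b%:R ^+ W + h%:R / b%:R ^+ W :> R.
  by rewrite -mulrA mulr_natl mulr2n.
apply: lerD; last first.
  apply: nint_dist_pow; have [ee'|/far] := leqP e' e; last by move: nm; clear; lia.
  by move: (no _ ee'); clear; lia.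
have [->|ne] := eqVneq (e' : nat) e.
  rewrite -mE mul1r (_ : _ - _ = (0%:Z)%:~R) ?nint_dist_int ?divr_ge0 ?exprn_ge0 ?(ltW b0)//.
  by rewrite exprS; field; rewrite expf_neq0 ?gt_eqF.
rewrite mul0r subr0; apply: nint_dist_pow.
case: (ltngtP e' e) ne => // [ee' _|/far]; last by clear; lia.
left; rewrite -ltnS mE ltn_pmul2l// ltn_exp2l//.
Qed.

(** With m' = r m + v and n' = r n + v the frequency is h' (b^m' - b^n'). For fixed m, each of the
    O(L) places j 2^e' excludes at most W = 2L values n; the other terms are O(M b^-W) = O(2^-L),
    since M = O(N). *)
Lemma energy_dependent cM r S h : (0 < r)%N -> S = (b ^ r)%N -> (0 < h)%N ->
  exists C g : R, [/\ 0 <= C, 0 <= g < 1 & forall L N M,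
    (2 ^ L <= N < 2 ^ L.+1)%N -> (2 * b ^ 2 * (h * S ^ (2 * N)) < b ^ M)%N ->
    (M < cM * N)%N -> energy R b S h N M <= C * g ^+ L * N%:R ^+ 2].
Proof.
move=> r0 SE h0; have [v [h' [hE bh']]] := exists_base_cofactor b_ge2 h0.
have p0 : 0 <= 2 * (pi *+ 2) :> R by rewrite mulr_ge0// mulrn_wge0// pi_ge0.
have [K KE] : exists K : R, K = b%:R * (2 * (pi *+ 2)) * (2 * h'%:R) * (2 * cM%:R) by eexists.
have bp0 : 0 <= b%:R * (2 * (pi *+ 2)) :> R by apply: mulr_ge0 => //; exact: ltW.
have K0 : 0 <= K.
  by rewrite KE; apply: mulr_ge0; [apply: mulr_ge0 => //|]; rewrite mulr_ge0.
have [c cE] : exists c, c = (cM + 7)%N by exists (cM + 7)%N.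
(* The rate is (5/4)^2 / 2: (L + c)^2 is at most c^2 (5/4)^(2L), while 2^L <= N. It also exceeds the
   rate 1/2 of the remaining terms. *)
exists (5 * c%:R ^+ 2 + 2 * K), (25 / 32); split.
- by apply: addr_ge0; apply: mulr_ge0 => //; exact: exprn_ge0.
- by apply/andP; split; lra.
move=> L N M /andP[LN NL] hM McN.
pose W := (2 * L)%N; pose B := ((L + c) ^ 2)%N.
have h'0 : (0 < h')%N by case: h' {KE} hE bh' => // _; rewrite dvdn0.
have bX0 k : 0 < b%:R ^+ k :> R by exact: exprn_gt0.
have row (m : 'I_N) : \sum_(n < N | (n < m)%N) char_mean R b M (freq_diff S h m n)
    <= 2 * B%:R + N%:R * (K / 2 ^+ L).
  pose m' := (r * m + v)%N.
  have m'M : (m' < M)%N.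
    rewrite -(@ltn_exp2l b)//; apply: leq_ltn_trans hM.
    rewrite expnD expnM -SE; apply: (@leq_trans (h * S ^ (2 * N))%N); last by rewrite leq_pmull// muln_gt0 expn_gt0 (ltnW b_ge2).
    rewrite mulnC; apply: leq_mul; first by rewrite hE leq_pmulr.
    rewrite leq_pexp2l ?SE ?expn_gt0 ?(ltnW b_ge2)//.
    by have := ltn_ord m; clear; lia.
  have [e [j [oj mE]]] : exists e j, odd j /\ m'.+1 = (j * 2 ^ e)%N.
    exists (logn 2 m'.+1), ((m'.+1)`_2^')%N; split; first exact: odd_part_odd.
    by rewrite -p_part mulnC partnC.
  have eL : (e <= L + cM)%N.
    have : (2 ^ e < 2 ^ (L + cM).+1)%N.
      apply: (@leq_ltn_trans m'.+1); first by rewrite mE leq_pmull//; case: (j) oj.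
      apply: (leq_ltn_trans m'M); apply: (ltn_trans McN).
      apply: (@leq_ltn_trans (2 ^ cM * N)); first by rewrite leq_mul2r ltnW ?orbT// ltn_expl.
      by rewrite -addSn addnC expnD ltn_pmul2l ?expn_gt0.
    by rewrite ltn_exp2l// ltnS.
  pose bad (n : 'I_N) := [exists e' : 'I_e.+1, (r * n + v < j * 2 ^ e' <= r * n + v + W)%N].
  have term (n : 'I_N) : (n < m)%N -> (W <= m')%N -> ~~ bad n ->
      char_mean R b M (freq_diff S h m n) <= K / 2 ^+ L.
    move=> nm Wm /existsPn nb; pose n' := (r * n + v)%N.
    have nm' : (n' < m')%N by rewrite ltn_add2r ltn_pmul2l.
    have -> : freq_diff S h m n = (h' * (b ^ m' - b ^ n'))%N.
      rewrite /freq_diff (_ : S ^ n - S ^ m = 0)%N ?addn0; last first.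
        by apply/eqP; rewrite subn_eq0 leq_pexp2l ?SE ?expn_gt0 ?(ltnW b_ge2)// ltnW.
      by rewrite /m' /n' !expnD !expnM -SE -mulnBl hE; move: (_ - _)%N => z; ring.
    apply: le_trans (@char_mean_dependent h' m' n' W e j M bh' nm' mE oj m'M Wm _) _.
      by move=> e' ee'; exact: (nb (Ordinal (n := e.+1) (m := e') ee')).
    have bW : (b%:R ^+ W)^-1 <= (2 ^+ L * 2 ^+ L)^-1 :> R.
      rewrite lef_pV2 ?posrE ?mulr_gt0 ?exprn_gt0// -exprD addnn -mul2n.
      by apply: lerXn2r; rewrite ?nnegrE// ler_nat.
    have ML : M.+1%:R <= cM%:R * (2 * 2 ^+ L) :> R.
      rewrite -natrX -!natrM ler_nat; apply: (leq_trans McN).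
      by rewrite leq_mul2l -expnS ltnW ?orbT.
    apply: (@le_trans _ _ (b%:R * (2 * (pi *+ 2)) *
        (cM%:R * (2 * 2 ^+ L) * (2 * h'%:R)) / (2 ^+ L * 2 ^+ L))).
      apply: ler_pM; last exact: bW.
      - by apply: mulr_ge0 => //; rewrite !mulr_ge0.
      - by rewrite invr_ge0 ltW.
      - apply: ler_wpM2l => //.
        by apply: ler_wpM2r => //; rewrite mulr_ge0.
    rewrite KE le_eqVlt; apply/orP; left; apply/eqP; field.
    by rewrite expf_neq0.
  (* A row with m' < W has fewer than W entries, each at most 1. *)
  have [Wm|mW] := leqP W m'; last first.
    apply: (@le_trans _ _ (2 * B%:R)); last first.
      by rewrite lerDl mulr_ge0// divr_ge0// exprn_ge0.
    apply: (@le_trans _ _ (\sum_(n < N | (n < m)%N) 1)).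
      by apply: ler_sum => n _; exact: char_mean_le1.
    rewrite sumr_const -natrM ler_nat.
    have -> : #|[pred n : 'I_N | (n < m)%N]| = #|[set n : 'I_N | (1 * n + 0 < m <= 1 * n + 0 + m)%N]%SET|.
      by rewrite cardsE; apply: eq_card => n; rewrite !inE; lia.
    apply: leq_trans (card_window _ _ _ _ _) _ => //.
    have mm : (m <= m')%N by rewrite /m' (leq_trans _ (leq_addr _ _))// leq_pmull.
    rewrite /B /W in mW *; have cL : (0 < L + c)%N by rewrite cE; clear; lia.
    rewrite -mulnn; apply: leq_trans mm _; apply: leq_trans (ltnW mW) _.
    rewrite leq_mul2l /=; apply: leq_trans (leq_addr c L) _; exact: leq_pmulr.
  have card_bad : (#|[set n | bad n]%SET| <= 2 * B)%N.
    apply: (@leq_trans (\sum_(e' < e.+1)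
        #|[set n : 'I_N | (r * n + v < j * 2 ^ e' <= r * n + v + W)%N]%SET|)).
      rewrite -sum1_card big_mkcond /=.
      under [X in (_ <= X)%N]eq_bigr => e' _ do rewrite -sum1_card big_mkcond /=.
      rewrite [X in (_ <= X)%N]exchange_big /=; apply: leq_sum => n _; rewrite inE.
      case: ifP => // /existsP[e' he']; rewrite (bigD1 e')//= inE he'.
      exact: leq_addr.
    apply: (@leq_trans (\sum_(e' < e.+1) W)).
      by apply: leq_sum => e' _; exact: card_window.
    rewrite sum_nat_const card_ord /W /B -mulnn cE mulnCA leq_mul2l /=.
    by apply: leq_mul; move: eL; clear; lia.
  apply: (@le_trans _ _ (\sum_(n < N) ((bad n)%:R + K / 2 ^+ L))).
    have KL0 : 0 <= K / 2 ^+ L by rewrite divr_ge0// exprn_ge0.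
    rewrite big_mkcond /=; apply: ler_sum => n _; case: ifP => [nm|_]; last exact: addr_ge0.
    have [bn|nbn] := boolP (bad n); last by rewrite add0r; exact: term.
    by apply: le_trans (@char_mean_le1 R b b_ge2 _ _) _; rewrite lerDl.
  rewrite big_split /= sumr_const card_ord -[_ *+ N]mulr_natl lerD2r.
  rewrite -natrM -natr_sum ler_nat; apply: leq_trans card_bad.
  by rewrite -sum1_card [X in (_ <= X)%N]big_mkcond /=; apply: leq_sum => n _; rewrite inE; case: (bad n).
apply: le_trans (@energy_le R b b_ge2 S h N M) _.
have {row} : \sum_(m < N) \sum_(n < N | (n < m)%N) char_mean R b M (freq_diff S h m n)
    <= N%:R * (2 * B%:R + N%:R * (K / 2 ^+ L)).
  apply: (@le_trans _ _ (\sum_(m < N) (2 * B%:R + N%:R * (K / 2 ^+ L)))).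
    by apply: ler_sum => m _; exact: row.
  by rewrite sumr_const card_ord -[_ *+ N]mulr_natl.
set E := \sum_(m < N) _ => hE'.
have N0 : 0 <= N%:R :> R by [].
have LN' : 2 ^+ L <= N%:R :> R by rewrite -natrX ler_nat.
have g1 : 1 <= 5 / 4 :> R by lra.
have cL : (L + c)%:R <= c%:R * (5 / 4) ^+ L :> R.
  have : 1 + L%:R / 4 <= (5 / 4) ^+ L :> R.
    elim: (L) => [|k IH]; first by rewrite mul0r addr0 expr0.
    rewrite exprSr -natr1; have : 0 <= k%:R :> R by []. nra.
  have : 4 <= c%:R :> R by rewrite ler_nat cE; clear; lia.
  rewrite natrD; have : 0 <= L%:R :> R by []. nra.
have BL : B%:R <= c%:R ^+ 2 * ((25 / 32) ^+ L * N%:R) :> R.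
  apply: (@le_trans _ _ (c%:R ^+ 2 * ((25 / 32) ^+ L * 2 ^+ L))); last first.
    by rewrite ler_wpM2l ?exprn_ge0// ler_wpM2l// exprn_ge0//; lra.
  rewrite -exprMn (_ : 25 / 32 * 2 = (5 / 4) ^+ 2); last by field.
  by rewrite exprAC -exprMn /B natrX; apply: lerXn2r; rewrite ?nnegrE.
have B1 : 1 <= B%:R :> R by rewrite ler1n /B expn_gt0 cE addnA addn_gt0 orbT.
have KL : K / 2 ^+ L <= K * (25 / 32) ^+ L.
  by rewrite ler_wpM2l// -exprVn; apply: lerXn2r; rewrite ?nnegrE; lra.
have e1 : N%:R <= N%:R * B%:R :> R by rewrite ler_peMr.
have e2 : N%:R * B%:R <= N%:R * (c%:R ^+ 2 * ((25 / 32) ^+ L * N%:R)) :> R by rewrite ler_wpM2l.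
have e3 : N%:R * (N%:R * (K / 2 ^+ L)) <= N%:R * (N%:R * (K * (25 / 32) ^+ L)).
  by apply: ler_wpM2l => //; exact: ler_wpM2l.
rewrite (_ : (_ + _) * _ * _ = 5 * (N%:R * (c%:R ^+ 2 * ((25 / 32) ^+ L * N%:R)))
  + 2 * (N%:R * (N%:R * (K * (25 / 32) ^+ L)))); last by ring.
rewrite mulrDr in hE'.
move: hE' e1 e2 e3; rewrite [N%:R * (2 * _)]mulrCA.
move: (N%:R * B%:R) (N%:R * (N%:R * (K / 2 ^+ L))) (N%:R * (c%:R ^+ 2 * _)) (N%:R * (N%:R * (K * _))).
by move=> *; lra.
Qed.

End dependent_energy.

(** * Weyl's criterion *)

Section weyl_criterion.
Variable R : realType.
Implicit Types (x y c : R).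

Local Notation "2pi" := (pi *+ 2 : R).

Lemma normc_sum_cis_sqr (u : nat -> R) N : normc (\sum_(k < N) cis (u k)) ^+ 2 =
  \sum_(k < N) \sum_(j < N) cos ((u k - u j) * 2pi).
Proof.
have Re_sum (v : nat -> R) : complex.Re (\sum_(k < N) cis (v k)) = \sum_(k < N) cos (v k * 2pi).
  exact: (raddf_sum (@complex.Re R : {additive R[i] -> R})).
have Im_sum (v : nat -> R) : complex.Im (\sum_(k < N) cis (v k)) = \sum_(k < N) sin (v k * 2pi).
  exact: (raddf_sum (@complex.Im R : {additive R[i] -> R})).
rewrite normc_sqr Re_sum Im_sum !expr2 !mulr_suml -big_split /=.
apply: eq_bigr => k _; rewrite !mulr_sumr -big_split /=.
by apply: eq_bigr => j _; rewrite mulrBl cosB.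
Qed.

(** * The Fejer kernel *)

Definition fejer (Q : nat) y : R := normc (\sum_(k < Q) cis (k%:R * y)) ^+ 2 / Q%:R.

Lemma fejer_ge0 Q y : 0 <= fejer Q y.
Proof. by rewrite divr_ge0// exprn_ge0// normc_ge0. Qed.

Lemma fejerE Q y : fejer Q y =
  (\sum_(k < Q) \sum_(j < Q) cos ((k%:R * y - j%:R * y) * 2pi)) / Q%:R.
Proof. by rewrite /fejer (normc_sum_cis_sqr (fun k => k%:R * y)). Qed.

(** Expanding the square, the Q diagonal pairs give #|P| each and every other pair is an exponential
    sum of frequency between 1 and Q - 1. *)
Lemma sum_fejer (I : finType) (P : pred I) Q (u : I -> R) (e : R) : (0 < Q)%N -> 0 <= e ->
  (forall h, (0 < h < Q)%N -> normc (\sum_(i | P i) cis (h%:R * u i)) <= e) ->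
  \sum_(i | P i) fejer Q (u i) <= (#|P|)%:R + Q%:R * e.
Proof.
move=> Q0 e0 he; have Q0' : 0 < Q%:R :> R by rewrite ltr0n.
under eq_bigr do rewrite fejerE; rewrite -mulr_suml ler_pdivrMr//.
rewrite exchange_big /=; under eq_bigr do rewrite exchange_big /=.
have pair (k j : 'I_Q) :
    \sum_(i | P i) cos ((k%:R * u i - j%:R * u i) * 2pi) <= (k == j)%:R * (#|P|)%:R + e.
  have [->|kj] := eqVneq k j.
    under eq_bigr do rewrite subrr mul0r cos0.
    by rewrite sumr_const mul1r lerDl.
  rewrite mul0r add0r.
  wlog lt : k j kj / (j < k)%N => [wl|].
    case: (ltngtP j k) => [h|h|/val_inj e1]; first exact: wl.
      under eq_bigr do rewrite -cosN -mulNr opprB.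
      by apply: wl => //; rewrite eq_sym.
    by rewrite e1 eqxx in kj.
  apply: le_trans (he (k - j)%N _); last by have := ltn_ord k; lia.
  apply: le_trans (Re_le_normc _); apply: le_trans (ler_norm _).
  rewrite le_eqVlt; apply/orP; left; apply/eqP.
  rewrite [RHS](raddf_sum (@complex.Re R : {additive R[i] -> R})).
  by apply: eq_bigr => i _; rewrite -mulrBl -natrB// ltnW.
apply: (@le_trans _ _ (\sum_(k < Q) \sum_(j < Q) ((k == j)%:R * (#|P|)%:R + e))).
  by apply: ler_sum => k _; apply: ler_sum => j _; exact: pair.
apply: (@le_trans _ _ (\sum_(k < Q) ((#|P|)%:R + Q%:R * e))); last first.
  by rewrite sumr_const card_ord -[_ *+ Q]mulr_natr.
apply: ler_sum => k _; rewrite big_split /= sumr_const card_ord -[e *+ Q]mulr_natl lerD2r.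
rewrite (bigD1 k)//= eqxx mul1r big1 ?addr0// => j jk.
by rewrite eq_sym (negPf jk) mul0r.
Qed.

(* The Fejer kernel has degree Q - 1, so its translates by r / Q sum to a constant. *)
Lemma fejer_partition Q y : (0 < Q)%N -> \sum_(r < Q) fejer Q (y - r%:R / Q%:R) = Q%:R.
Proof.
move=> Q0; have Q0' : 0 < Q%:R :> R by rewrite ltr0n.
under eq_bigr do rewrite fejerE; rewrite -mulr_suml.
rewrite exchange_big /=; under eq_bigr do rewrite exchange_big /=.
have pair (k j : 'I_Q) :
    \sum_(r < Q) cos ((k%:R * (y - r%:R / Q%:R) - j%:R * (y - r%:R / Q%:R)) * 2pi)
    = (k == j)%:R * Q%:R.
  have [->|kj] := eqVneq k j.
    under eq_bigr do rewrite subrr mul0r cos0.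
    by rewrite sumr_const card_ord mul1r.
  rewrite mul0r.
  wlog lt : k j kj / (j < k)%N => [wl|].
    case: (ltngtP j k) => [h|h|/val_inj e1]; first exact: wl.
      under eq_bigr do rewrite -cosN -mulNr opprB.
      by apply: wl => //; rewrite eq_sym.
    by rewrite e1 eqxx in kj.
  have kQ : ~~ (Q %| k - j)%N.
    by apply/negP => /dvdn_leq; rewrite subn_gt0 => /(_ lt); have := ltn_ord k; lia.
  transitivity (complex.Re (cis (- ((k - j)%:R * y)) *
      \sum_(r < Q) cis (r%:R * ((k - j)%:R / Q%:R)))); last first.
    by rewrite sum_cis_eq0// mulr0.
  rewrite mulr_sumr [RHS](raddf_sum (@complex.Re R : {additive R[i] -> R})).
  apply: eq_bigr => r _; rewrite -cisD -cosN /= natrB ?(ltnW lt)//; congr cos.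
  by field; rewrite gt_eqF.
under eq_bigr => k _ do under eq_bigr => j _ do rewrite pair.
rewrite (eq_bigr (fun=> Q%:R)); last first.
  move=> k _; rewrite (bigD1 k)//= eqxx mul1r big1 ?addr0// => j jk.
  by rewrite eq_sym (negPf jk) mul0r.
by rewrite sumr_const card_ord -[_ *+ Q]mulr_natl mulfK// gt_eqF.
Qed.

(** Multiplied by [cis y - 1], the geometric sum telescopes to a number of modulus at most 2. *)
Lemma fejer_tail Q eta y : 0 < eta -> eta <= 2^-1 -> eta <= nint_dist y ->
  fejer Q y <= 4 / (2 - 2 * cos (eta * 2pi)) / Q%:R.
Proof.
move=> e0 e2 ey; have d0 : 0 < 2 - 2 * cos (eta * 2pi) by have := cos_lt1 e0 e2; lra.
rewrite /fejer ler_wpM2r ?invr_ge0// ler_pdivlMr//.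
set s := normc _; have s0 : 0 <= s ^+ 2 by rewrite exprn_ge0// normc_ge0.
apply: (@le_trans _ _ (s ^+ 2 * normc (cis y - 1) ^+ 2)).
  by rewrite ler_wpM2l// normc_cis1_sqr; have := cos_nint_dist_le e0 ey; lra.
rewrite -exprMn [s * _]mulrC -normcM sum_cis.
have : normc (cis (Q%:R * y) - 1) <= 2.
  by apply: le_trans (normcD _ _) _; rewrite normcN normc_cis normc1.
have := normc_ge0 (cis (Q%:R * y) - 1); set z := normc _; nra.
Qed.

(** Subtracting from r the multiple of Q nearest in this sense gives distinct integers in an
    interval of length 2 rho Q around Q m. *)
Lemma card_near_grid (Q : nat) (m rho : R) : (0 < Q)%N -> 0 <= rho ->
  (#|[set r : 'I_Q | nint_dist (r%:R / Q%:R - m) < rho]%SET|)%:R <= 2 * rho * Q%:R + 3.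
Proof.
move=> Q0 rho0; have Q0' : 0 < Q%:R :> R by rewrite ltr0n.
pose k (r : 'I_Q) := Num.floor (r%:R / Q%:R - m + 2^-1).
pose s (r : 'I_Q) : int := r%:Z - Q%:Z * k r.
pose a := Num.floor (Q%:R * m - rho * Q%:R).
pose B := (Num.truncn (2 * rho * Q%:R)).+2.
set A := [set r | _]%SET.
have sA r : r \in A -> (a <= s r)%R /\ (s r - a < B)%R.
  rewrite inE /nint_dist -/(k r) ltr_norml => /andP[h1 h2].
  have sE : (s r)%:~R = (r%:R / Q%:R - m - (k r)%:~R) * Q%:R + Q%:R * m :> R.
    by rewrite intrB intrM -!pmulrn; field; rewrite gt_eqF.
  have l1 : Q%:R * m - rho * Q%:R < (s r)%:~R by rewrite sE; nra.
  have l2 : (s r)%:~R < Q%:R * m + rho * Q%:R by rewrite sE; nra.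
  have af : a%:~R <= Q%:R * m - rho * Q%:R by exact: floor_le_tmp.
  have af1 : Q%:R * m - rho * Q%:R < (a + 1)%:~R by exact: floorD1_gt.
  split; first by rewrite -(ler_int R); lra.
  have tB : 2 * rho * Q%:R < (Num.truncn (2 * rho * Q%:R)).+1%:R.
    by case/andP: (truncn_itv (mulr_ge0 (mulr_ge0 (ler0n R 2) rho0) (ltW Q0'))).
  rewrite -(ltr_int R) intrB /B -pmulrn -natr1; rewrite intrD in af1; lra.
pose F (r : 'I_Q) : 'I_B := inord `|s r - a|%N.
have Finj : {in A &, injective F}.
  move=> r1 r2 /sA[a1 b1] /sA[a2 b2] /(congr1 val); rewrite /= !inordK; try lia.
  move=> h; have {}h : s r1 = s r2 by lia.
  move: h; rewrite /s => h; apply/val_inj => /=.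
  have := ltn_ord r1; have := ltn_ord r2 => h2 h1.
  have : (k r1 = k r2 \/ k r1 - k r2 >= 1 \/ k r2 - k r1 >= 1)%R by lia.
  case=> [e|[e|e]]; [by rewrite e in h; lia|exfalso; nia|exfalso; nia].
rewrite -(card_in_imset Finj).
apply: (@le_trans _ _ B%:R); first by rewrite ler_nat -[X in (_ <= X)%N]card_ord max_card.
rewrite /B -natr1 -natr1.
have := truncn_itv (mulr_ge0 (mulr_ge0 (ler0n R 2) rho0) (ltW Q0')) => /andP[? _].
lra.
Qed.

(** * From exponential sums to digit frequencies *)

Definition weyl_small (y : nat -> R) := forall h, (0 < h)%N -> forall e, 0 < e ->
  exists N0, forall N, (N0 <= N)%N -> normc (\sum_(n < N) cis (h%:R * y n)) <= e * N%:R.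

Lemma weyl_small_upto (y : nat -> R) Q e : weyl_small y -> 0 < e -> exists N0, forall N h,
  (N0 <= N)%N -> (0 < h < Q)%N -> normc (\sum_(n < N) cis (h%:R * y n)) <= e * N%:R.
Proof.
move=> wy e0; elim: Q => [|Q [N0 IH]]; first by exists 0%N => N h _; lia.
have [->|Q0] := posnP Q; first by exists 0%N => N h _; lia.
have [N1 h1] := wy _ Q0 _ e0; exists (maxn N0 N1) => N h; rewrite geq_max => /andP[l0 l1].
rewrite ltnS => /andP[h0]; rewrite leq_eqVlt => /predU1P[->|hQ]; first exact: h1.
by apply: IH => //; rewrite h0.
Qed.

(* The translates of the Fejer kernel near m form a trigonometric majorant (up to
   tau) of the indicator of the interval. Upper bounds suffice for normality, because
   the digit frequencies sum to 1. *)
Lemma weyl_upper (y : nat -> R) (m ell tau : R) : weyl_small y -> 0 <= ell -> 0 < tau -> tau <= 2^-1 ->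
  exists N0, forall N, (N0 <= N)%N ->
  (#|[set n : 'I_N | nint_dist (y n - m) <= ell]%SET|)%:R <=
    ((2 * ell + 3 * tau) * (1 + tau) + tau) * N%:R.
Proof.
move=> wy ell0 tau0 tau2.
have d0 : 0 < 2 - 2 * cos (tau * 2pi) by have := cos_lt1 tau0 tau2; lra.
set dl := 4 / (2 - 2 * cos (tau * 2pi)).
have dl0 : 0 < dl by rewrite divr_gt0.
(* This Q makes both the kernel tails, dl in total, and the rounding term 3 of [card_near_grid] at
   most tau Q. *)
pose Q := (Num.truncn ((dl + 3) / tau)).+1.
have Q0 : (0 < Q)%N by []. have Q0' : 0 < Q%:R :> R by rewrite ltr0n.
have Qt : dl + 3 < Q%:R * tau.
  rewrite -ltr_pdivrMr//.
  by have /andP[] := truncn_itv (ltW (divr_gt0 (ltr_wpDr (ler0n R 3) dl0) tau0)).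
have [N0 hN0] := weyl_small_upto Q wy (divr_gt0 tau0 Q0').
exists N0 => N /hN0 hN; set A := [set n | _]%SET.
pose G := [set r : 'I_Q | nint_dist (r%:R / Q%:R - m) < ell + tau]%SET.
have cG : (#|G|)%:R <= (2 * ell + 3 * tau) * Q%:R.
  apply: le_trans (card_near_grid _ Q0 _) _; first by lra.
  by move: Qt dl0; nra.
(* Grid points outside G are at distance at least tau from y n, so nearly all of the constant sum Q
   of the translates comes from G. *)
have low n : n \in A -> (1 - tau) * Q%:R <= \sum_(r in G) fejer Q (y n - r%:R / Q%:R).
  rewrite inE => yn; have := fejer_partition (y n) Q0.
  rewrite (bigID (mem G)) /= => h.
  have : \sum_(r < Q | r \notin G) fejer Q (y n - r%:R / Q%:R) <= dl.
    apply: (@le_trans _ _ (\sum_(r < Q) dl / Q%:R)); last first.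
      by rewrite sumr_const card_ord -[_ *+ Q]mulr_natr divfK// gt_eqF.
    rewrite big_mkcond; apply: ler_sum => r _; case: ifP => [|_]; last first.
      by rewrite divr_ge0// ltW.
    rewrite inE -leNgt => hr; apply: fejer_tail => //.
    have := nint_distD (y n - m) (r%:R / Q%:R - y n).
    rewrite (_ : y n - m + _ = r%:R / Q%:R - m); last by ring.
    rewrite -[nint_dist (_ - y n)]nint_distN opprB; lra.
  move: h; set u := \sum_(r in G) _; set v := \sum_(r < Q | _) _; nra.
have up r : \sum_(n < N) fejer Q (y n - r%:R / Q%:R) <= (1 + tau) * N%:R.
  rewrite mulrDl mul1r.
  have := @sum_fejer _ xpredT Q (fun n : 'I_N => y n - r%:R / Q%:R) (tau / Q%:R * N%:R) Q0.
  rewrite cardT size_enum_ord mulrA [Q%:R * _]mulrC divfK ?gt_eqF//; apply.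
    by rewrite mulr_ge0// divr_ge0// ltW.
  move=> h hh; apply: le_trans (hN _ hh).
  under eq_bigr do rewrite mulrBr cisD.
  by rewrite -mulr_suml normcM normc_cis mulr1.
have key : (#|A|)%:R * ((1 - tau) * Q%:R) <= (#|G|)%:R * ((1 + tau) * N%:R).
  apply: (@le_trans _ _ (\sum_(n in A) \sum_(r in G) fejer Q (y n - r%:R / Q%:R))).
    rewrite mulr_natl -sumr_const; apply: ler_sum => n; exact: low.
  rewrite exchange_big /= mulr_natl -sumr_const; apply: ler_sum => r _.
  apply: le_trans (up r); rewrite big_mkcond; apply: ler_sum => n _.
  by case: ifP => // _; exact: fejer_ge0.
have AN : (#|A|)%:R <= N%:R :> R by rewrite ler_nat -[X in (_ <= X)%N]card_ord max_card.
have {}key : (#|A|)%:R * (1 - tau) <= (2 * ell + 3 * tau) * (1 + tau) * N%:R.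
  rewrite -(ler_pM2r Q0') -[leLHS]mulrA; apply: le_trans key _.
  rewrite [leRHS](_ : _ = (2 * ell + 3 * tau) * Q%:R * ((1 + tau) * N%:R)); last by ring.
  by apply: ler_wpM2r => //; rewrite mulr_ge0//; lra.
rewrite [leRHS]mulrDl; have : (#|A|)%:R * tau <= tau * N%:R by rewrite mulrC ler_wpM2l// ltW.
lra.
Qed.

(** Digit n + 1 is read off S^n x modulo 1: it is d on an interval of centre (d + 1/2) / S and
    half-length 1 / (2S). *)
Lemma digit_near S x n (d : 'I_S) : (0 < S)%N -> digit S x n.+1 = d :> int ->
  nint_dist (S%:R ^+ n * x - (d%:R + 2^-1) / S%:R) <= (2 * S%:R)^-1.
Proof.
move=> S0; rewrite /digit; set f := Num.floor _ => fd.
have S0' : 0 < S%:R :> R by rewrite ltr0n.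
have fE : f = (f %/ S)%Z * S%:Z + d by rewrite -fd; exact: divz_eq.
apply: le_trans (nint_dist_le _ (f %/ S)%Z) _.
have h1 : f%:~R <= x * S%:R ^+ n.+1 by exact: floor_le_tmp.
have h2 : x * S%:R ^+ n.+1 < (f + 1)%:~R by exact: floorD1_gt.
rewrite intrD in h2.
have fE' : f%:~R = (f %/ S)%Z%:~R * S%:R + d%:R :> R by rewrite {1}fE intrD intrM.
rewrite (_ : _ - _ - _ = (x * S%:R ^+ n.+1 - f%:~R - 2^-1) / S%:R); last first.
  by rewrite fE' exprSr; field; rewrite gt_eqF.
have Si0 : 0 <= S%:R^-1 :> R by rewrite invr_ge0 ltW.
rewrite normrM [`|S%:R^-1|]ger0_norm// [leRHS]invfM; apply: ler_wpM2r => //.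
by rewrite ler_norml; apply/andP; split; lra.
Qed.

Lemma digit_bounds S x j : (0 < S)%N -> (0 <= digit S x j < S%:Z)%R.
Proof. by move=> S0; rewrite /digit modz_ge0 ?ltz_pmod//; lia. Qed.

Lemma sum_digit_count S x N : (0 < S)%N ->
  (\sum_(d < S) \sum_(1 <= j < N.+1) (digit S x j == d :> int) = N)%N.
Proof.
move=> S0; rewrite exchange_big /= (eq_bigr (fun=> 1%N)).
  by rewrite sum_nat_const_nat muln1 subn1.
move=> j _; have /andP[d0 dS] := digit_bounds x j S0.
have dS' : (`|digit S x j| < S)%N by lia.
rewrite (bigD1 (Ordinal dS'))//= gez0_abs// eqxx big1 ?addn0// => i.
by rewrite -val_eqE /= => /eqP ne; apply/eqP; rewrite eqb0; apply/eqP; lia.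
Qed.

(** The lower bound for one digit comes from the upper bounds for the S - 1 others, the counts
    adding up to N; this multiplies the error by S and dictates the choice of [tau]. *)
Lemma simply_normal_of_weyl S x : (0 < S)%N ->
  weyl_small (fun n => S%:R ^+ n * x) -> simply_normal_base S x.
Proof.
move=> S0 wx d; have S0' : 0 < S%:R :> R by rewrite ltr0n.
have S1 : 1 <= S%:R :> R by rewrite ler1n.
pose cnt (i : 'I_S) N := (\sum_(1 <= j < N.+1) (digit S x j == i :> int))%N.
have upper tau : 0 < tau -> tau <= 2^-1 -> exists N0, forall N (i : 'I_S), (N0 <= N)%N ->
    (cnt i N)%:R <= (S%:R^-1 + 8 * tau) * N%:R :> R.
  move=> t0 t2.
  have /choice[f hf] (i : 'I_S) : exists N0, forall N, (N0 <= N)%N ->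
      (cnt i N)%:R <= (S%:R^-1 + 8 * tau) * N%:R :> R.
    have l0 : 0 <= (2 * S%:R)^-1 :> R by rewrite invr_ge0 mulr_ge0.
    have [N0 hN0] := weyl_upper ((i%:R + 2^-1) / S%:R) wx l0 t0 t2.
    exists N0 => N /hN0 hN; apply: le_trans (le_trans _ hN) _.
      rewrite ler_nat /cnt big_add1 /= big_mkord -sum1_card [X in (_ <= X)%N]big_mkcond /=.
      apply: leq_sum => n _; rewrite inE; case: eqP => //= e.
      by rewrite (digit_near S0 e).
    apply: ler_wpM2r => //.
    have -> : 2 * (2 * S%:R)^-1 = S%:R^-1 :> R by field; rewrite gt_eqF.
    have : 0 <= S%:R^-1 :> R by rewrite invr_ge0.
    have : S%:R^-1 <= 1 :> R by rewrite invf_le1.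
    by move: (S%:R^-1) => z; nra.
  exists (\max_i f i)%N => N i hN; apply: hf; apply: leq_trans hN.
  exact: (leq_bigmax i).
apply/cvgrPdist_le => e e0.
pose tau := Num.min 2^-1 (e / (8 * S%:R)).
have t0 : 0 < tau by rewrite lt_min invr_gt0 ltr0n /= divr_gt0// mulr_gt0.
have t2 : tau <= 2^-1 by rewrite ge_min lexx.
have te : 8 * tau * S%:R <= e.
  by rewrite -mulrA mulrCA -ler_pdivlMr ?mulr_gt0// ge_min lexx orbT.
have [N0 hN0] := upper _ t0 t2.
exists N0.+1 => // N /= NN0; have N0' : 0 < N%:R :> R by rewrite ltr0n; apply: leq_trans NN0.
have up i := hN0 N i (ltnW NN0).
have lo : (S%:R^-1 - S%:R * (8 * tau)) * N%:R <= (cnt d N)%:R.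
  have := sum_digit_count x N S0; rewrite (bigD1 d)//= -/(cnt d N) => /(congr1 (GRing.natmul (1 : R))).
  rewrite natrD natr_sum => cE.
  have : \sum_(i < S | i != d) (cnt i N)%:R <= (S%:R - 1) * ((S%:R^-1 + 8 * tau) * N%:R) :> R.
    apply: (@le_trans _ _ (\sum_(i < S | i != d) (S%:R^-1 + 8 * tau) * N%:R)).
      by apply: ler_sum => i _; exact: up.
    rewrite sumr_const -[_ *+ _]mulr_natl; apply: ler_wpM2r.
      by rewrite mulr_ge0// addr_ge0 ?invr_ge0// mulr_ge0// ltW.
    have := cardC1 d; rewrite card_ord => /(congr1 (fun k => k%:R : R)) /=.
    rewrite (_ : #|predC1 d| = #|[pred i | i != d]|) // => ->.
    by rewrite -subn1 natrB.
  rewrite /= in cE; move: cE; set u := \sum_(i < S | _) _; set v := (cnt d N)%:R => cE hu.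
  have e1 : (S%:R - 1) * ((S%:R^-1 + 8 * tau) * N%:R) =
    N%:R - S%:R^-1 * N%:R + S%:R * (8 * tau) * N%:R - 8 * tau * N%:R.
    by field; rewrite gt_eqF.
  have : 0 <= 8 * tau * N%:R by rewrite !mulr_ge0// ltW.
  have cE' : v + u = N%:R by [].
  rewrite mulrBl; lra.
have lo' : S%:R^-1 - e <= (cnt d N)%:R / N%:R.
  rewrite ler_pdivlMr//; apply: le_trans lo; apply: ler_wpM2r => //.
  by rewrite lerD2l lerN2 mulrC.
have up' : (cnt d N)%:R / N%:R <= S%:R^-1 + e.
  rewrite ler_pdivrMr//; apply: le_trans (up d) _; apply: ler_wpM2r => //.
  by rewrite lerD2l; apply: le_trans te; rewrite ler_peMr// mulr_ge0// ltW.
change (`|S%:R^-1 - (cnt d N)%:R / N%:R| <= e).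
by rewrite ler_norml; apply/andP; split; lra.
Qed.

(** Splitting n = i + a n' gives, for each i < a, a sum for S^a at frequency h S^i, plus fewer than
    a leftover terms once N is divided by a. *)
Lemma weyl_small_power S a x : (0 < a)%N -> (0 < S)%N ->
  weyl_small (fun n => (S ^ a)%N%:R ^+ n * x) -> weyl_small (fun n => S%:R ^+ n * x).
Proof.
move=> a0 S0 wx h h0 e e0; have a0' : 0 < a%:R :> R by rewrite ltr0n.
have e20 : 0 < e / 2 by rewrite divr_gt0.
have /choice[f hf] (i : 'I_a) : exists N0, forall N, (N0 <= N)%N ->
    normc (\sum_(n < N) cis ((h * S ^ i)%N%:R * ((S ^ a)%N%:R ^+ n * x))) <= e / 2 * N%:R.
  by apply: wx => //; rewrite muln_gt0 h0 expn_gt0 S0.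
pose N1 := (\max_i f i)%N; pose N2 := (Num.truncn (2 * a%:R / e)).+1.
exists (maxn (a * N1.+1) N2) => N; rewrite geq_max => /andP[NN1 NN2].
have aN : a%:R <= e / 2 * N%:R.
  rewrite mulrAC ler_pdivlMr// -ler_pdivrMl// mulrC [a%:R * 2]mulrC; apply: ltW.
  have /andP[_ /lt_le_trans] := truncn_itv (ltW (divr_gt0 (mulr_gt0 (ltr0Sn R 1) a0') e0)).
  by apply; rewrite ler_nat.
pose q := (N %/ a)%N; pose F n := cis (h%:R * (S%:R ^+ n * x)).
have qN : (q * a <= N)%N by exact: leq_trunc_div.
have Nq : (N < q.+1 * a)%N by exact: ltn_ceil.
have qN1 : (N1 <= q)%N by rewrite leq_divRL// mulnC; apply: leq_trans NN1; rewrite leq_mul2l leqnSn orbT.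
rewrite -[X in normc X]/(\sum_(n < N) F n) -(big_mkord xpredT F).
rewrite (@big_cat_nat _ _ _ (q * a))//=; apply: le_trans (normcD _ _) _.
rewrite (_ : e * N%:R = e / 2 * N%:R + e / 2 * N%:R); last by field.
apply: lerD; last first.
  apply: le_trans (normc_sum _ _ _) _; under eq_bigr do rewrite normc_cis.
  rewrite sumr_const_nat; apply: le_trans aN; rewrite ler_nat.
  by move: Nq; rewrite mulSn; lia.
rewrite big_mkord sum_ord_muln exchange_big /=.
apply: le_trans (normc_sum _ _ _) _.
apply: (@le_trans _ _ (\sum_(i < a) e / 2 * q%:R)).
  apply: ler_sum => i _; apply: le_trans (hf i q _); last first.
    by apply: leq_trans qN1; exact: (leq_bigmax i).
  rewrite le_eqVlt; apply/orP; left; apply/eqP; congr normc; apply: eq_bigr => n _.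
  by rewrite /F; congr cis; rewrite natrM !natrX exprD -exprM [(a * n)%N]mulnC; ring.
rewrite sumr_const card_ord -[_ *+ a]mulr_natr -mulrA; apply: ler_wpM2l; first exact: ltW.
by rewrite -natrM ler_nat.
Qed.

End weyl_criterion.

HB.instance Definition _ (b : nat) :=
  isMeasurableFun.Build _ _ _ _ (@toeplitz b) (@measurable_toeplitz b).

(** * Almost sure convergence *)

Section almost_everywhere.
Variables (R : realType) (b : nat).
Hypothesis b_ge2 : (2 <= b)%N.
Variable lambda : probability (oseq b) R.
Hypothesis lambdaP : uniform_product lambda.

Let b0 : 0 < b%:R :> R. Proof. by rewrite ltr0n; lia. Qed.
Let bX0 i : 0 < b%:R ^+ i :> R. Proof. exact: exprn_gt0. Qed.

Let mu := distribution lambda (@toeplitz b).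

Lemma measureU_seq_le (d : measure_display) (T : measurableType d)
    (P : {measure set T -> \bar R}) (I : Type) (s : seq I) (F : I -> set T) :
  (forall i, measurable (F i)) ->
  (P (\big[setU/set0]_(i <- s) F i) <= \sum_(i <- s) P (F i))%E.
Proof.
move=> mF; elim: s => [|i s IH]; first by rewrite !big_nil measure0.
rewrite !big_cons; apply: le_trans (measureU2 _ _ _) _ => //.
  exact: bigsetU_measurable.
exact: leeD.
Qed.

Lemma cylinderE M (w : {ffun 'I_M -> alphabet b}) :
  [set a : oseq b | word_of M a = w] = [set a | forall i : 'I_M, a i = w i].
Proof.
apply/seteqP; split=> [a /= <- i|a /= h]; first by rewrite ffunE.
by apply/ffunP => i; rewrite ffunE.
Qed.

Lemma measurable_cylinder M (w : {ffun 'I_M -> alphabet b}) :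
  measurable [set a : oseq b | word_of M a = w].
Proof.
have -> : [set a : oseq b | word_of M a = w] =
    \bigcap_(i in [set: 'I_M]) [set a : oseq b | a i = w i].
  by rewrite cylinderE; apply/seteqP; split=> [a h i _|a h i]; exact: h.
apply: fin_bigcap_measurable => // i _.
by apply: sub_sigma_algebra; exists i, (w i).
Qed.

Lemma word_setE M (P : pred {ffun 'I_M -> alphabet b}) :
  [set a : oseq b | P (word_of M a)] =
  \big[setU/set0]_(w <- enum P) [set a : oseq b | word_of M a = w].
Proof.
rewrite -bigcup_seq; apply/seteqP; split=> [a /= Pa|a [w /= wP wE]].
  by exists (word_of M a) => //=; rewrite mem_enum.
by move: wP; rewrite mem_enum -wE.
Qed.

Lemma measurable_word_set M (P : pred {ffun 'I_M -> alphabet b}) :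
  measurable [set a : oseq b | P (word_of M a)].
Proof. by rewrite word_setE; apply: bigsetU_measurable => w _; exact: measurable_cylinder. Qed.

Lemma word_set_le M (P : pred {ffun 'I_M -> alphabet b}) :
  (lambda [set a : oseq b | P (word_of M a)] <= ((#|P|)%:R / b%:R ^+ M)%:E)%E.
Proof.
rewrite word_setE; apply: le_trans (measureU_seq_le _ _ _) _.
  by move=> w; exact: measurable_cylinder.
rewrite (eq_bigr (fun=> ((b%:R^-1) ^+ M)%:E)); last first.
  by move=> w _; rewrite cylinderE; exact: lambdaP.
rewrite sumEFin lee_fin big_const_seq count_predT -cardE iter_addr addr0 exprVn mulr_natl.
by []. Qed.

(* The number of digits after which x may be truncated when its first N multiples
   h S^n x are studied. *)
Definition trunc_len (S h N : nat) := (2 * S * N + h + 3)%N.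

(** Combines S^(2N) <= b^(2SN), h < b^h and 2 b^2 <= b^3. The length remains linear in N, as
    [energy_dependent] requires. *)
Lemma trunc_len_large S h N : (0 < S)%N ->
  (2 * b ^ 2 * (h * S ^ (2 * N)) < b ^ trunc_len S h N)%N.
Proof.
move=> S0; rewrite /trunc_len (expnD _ (_ + h)) (expnD _ _ h).
have e1 : (S ^ (2 * N) <= b ^ (2 * S * N))%N.
  have -> : (2 * S * N = S * (2 * N))%N by ring.
  rewrite [X in (_ <= X)%N]expnM; case: (2 * N)%N => // k; rewrite leq_exp2r//.
  exact/ltnW/ltn_expl.
have e2 : (h < b ^ h)%N by exact: ltn_expl.
have e3 : (2 * b ^ 2 <= b ^ 3)%N by rewrite (expnS _ 2) leq_mul2r b_ge2 orbT.
have bp k : (0 < b ^ k)%N by rewrite expn_gt0 (ltnW b_ge2).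
rewrite [X in (_ < X)%N]mulnC; apply: (@leq_ltn_trans (b ^ 3 * (h * b ^ (2 * S * N)))%N).
  exact: leq_mul e3 (leq_mul (leqnn h) e1).
by rewrite ltn_pmul2l// mulnC ltn_pmul2l.
Qed.

Definition weyl_sum (S h N : nat) (x : R) : R :=
  normc (\sum_(n < N) cis (h%:R * (S%:R ^+ n * x))).

(** Truncation makes membership depend on finitely many letters, so that it is measurable and its
    probability is a count of words. *)
Definition bad_set S h (e : R) N : set (oseq b) :=
  [set t | e * N%:R <= weyl_sum S h N (prefix_value R (trunc_len S h N) t)].

Lemma measurable_bad_set S h e N : measurable (bad_set S h e N).
Proof.
set M := trunc_len S h N.
rewrite /bad_set (_ : mkset _ = [set t : oseq b | [pred w : {ffun 'I_M -> alphabet b} |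
    e * N%:R <= weyl_sum S h N (prefix_value R M (seq_of w))] (word_of M t)]).
  exact: measurable_word_set.
by apply/funext => t /=; rewrite prefix_value_word.
Qed.

Lemma freq_diff_cos S h m n (x : R) :
  cos ((h%:R * (S%:R ^+ m * x) - h%:R * (S%:R ^+ n * x)) * (pi *+ 2)) =
  cos ((freq_diff S h m n)%:R * x * (pi *+ 2)).
Proof.
wlog le : m n / (S ^ n <= S ^ m)%N => [wl|].
  case/orP: (leq_total (S ^ n) (S ^ m)) => [/wl//|/wl e].
  by rewrite -cosN -mulNr opprB e freq_diffC.
congr (cos (_ * _)); rewrite /freq_diff natrM natrD natrB//.
have -> : (S ^ n - S ^ m = 0)%N by apply/eqP; rewrite subn_eq0.
by rewrite !natrX; ring.
Qed.

(** Chebyshev's inequality, with the second moment expanded over pairs m, n. *)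
Lemma bad_set_le S h (e : R) N : 0 < e -> (0 < N)%N ->
  (mu (bad_set S h e N) <=
    (energy R b S h N (trunc_len S h N) / (e * N%:R) ^+ 2)%:E)%E.
Proof.
move=> e0 N0; set M := trunc_len S h N.
have N0' : 0 < N%:R :> R by rewrite ltr0n.
pose X (w : {ffun 'I_M -> alphabet b}) := prefix_value R M (toeplitz (seq_of w)).
pose P := [pred w | e * N%:R <= weyl_sum S h N (X w)].
have -> : mu (bad_set S h e N) = lambda [set a : oseq b | P (word_of M a)].
  rewrite /mu /= /distribution /pushforward; congr (lambda _).
  by apply/funext => a; rewrite /bad_set /= prefix_value_toeplitz.
apply: le_trans (word_set_le _) _; rewrite lee_fin.
have eN0 : 0 < e * N%:R by exact: mulr_gt0.
rewrite ler_pdivrMr// mulrAC ler_pdivlMr ?exprn_gt0//.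
apply: (@le_trans _ _ (\sum_w weyl_sum S h N (X w) ^+ 2)).
  rewrite mulr_natl -sumr_const [leLHS]big_mkcond /=; apply: ler_sum => w _.
  case: ifP => [|_]; last by rewrite exprn_ge0// normc_ge0.
  by rewrite inE => hw; apply: lerXn2r; rewrite ?nnegrE ?normc_ge0// ltW.
under eq_bigr => w _ do
  rewrite /weyl_sum (normc_sum_cis_sqr (fun n => h%:R * (S%:R ^+ n * X w))).
rewrite exchange_big /= /energy mulr_suml; apply: ler_sum => m _.
rewrite exchange_big /= mulr_suml; apply: ler_sum => n _.
rewrite /char_mean divfK ?gt_eqF//; apply: le_trans (ler_norm _).
by under eq_bigr => w _ do rewrite freq_diff_cos.
Qed.

Lemma energy_bound S r S1 h : (1 < S)%N -> S = (b ^ r * S1)%N -> (0 < h)%N ->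
  S1 = 1%N \/ (1 < S1)%N /\ (exists2 p, prime p & (p %| b)%N /\ S1 = 1 %[mod p ^ 2]) ->
  exists C g : R, [/\ 0 <= C, 0 <= g < 1 & forall L N, (2 ^ L <= N < 2 ^ L.+1)%N ->
    energy R b S h N (trunc_len S h N) <= C * g ^+ L * N%:R ^+ 2].
Proof.
move=> Sgt1 SE h0 [S11|[S1gt [p pp [pb S1p]]]].
  have SE' : S = (b ^ r)%N by rewrite SE S11 muln1.
  have r0 : (0 < r)%N by rewrite lt0n; apply/eqP => r0; rewrite SE' r0 in Sgt1.
  have [C [g [C0 g01 H]]] := energy_dependent R b_ge2 (2 * S + h + 4) r0 SE' h0.
  exists C, g; split=> // L N LN; apply: H => //; first exact/trunc_len_large/ltnW.
  have N0 : (0 < N)%N by case/andP: LN => LN _; apply: leq_trans LN; rewrite expn_gt0.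
  by rewrite /trunc_len !mulnDl; move: N0; clear; nia.
have [C [g [C0 g01 H]]] := energy_independent R b_ge2 pp pb S1p S1gt SE h0.
by exists C, g; split=> // L N LN; apply: H => //; exact/trunc_len_large/ltnW.
Qed.

(** * Borel-Cantelli along a sparse set of lengths *)

Definition block_bad S h q j : set (oseq b) :=
  \big[setU/set0]_(i <- iota (2 ^ q) (2 ^ q)) bad_set S h (2 ^- q) (i * 2 ^ j).

Lemma measurable_block_bad S h q j : measurable (block_bad S h q j).
Proof. by apply: bigsetU_measurable => i _; exact: measurable_bad_set. Qed.

(** The lengths i 2^j of block j lie in [2^(q+j), 2^(q+j+1)), so the energy bound with L = q + j
    gives the block probability at most K g^j, which is summable. *)
Lemma limsup_block_bad S r S1 h q : (1 < S)%N -> S = (b ^ r * S1)%N -> (0 < h)%N ->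
  S1 = 1%N \/ (1 < S1)%N /\ (exists2 p, prime p & (p %| b)%N /\ S1 = 1 %[mod p ^ 2]) ->
  mu (lim_sup_set (block_bad S h q)) = 0%E.
Proof.
move=> Sgt1 SE h0 S1P; have [C [g [C0 /andP[g0 g1] H]]] := energy_bound Sgt1 SE h0 S1P.
apply: lim_sup_set_cvg0 => [j|]; first exact: measurable_block_bad.
pose K := (2 ^ q)%:R * (C * g ^+ q * (2 ^+ q) ^+ 2).
have K0 : 0 <= K by rewrite !mulr_ge0 ?exprn_ge0.
have block_le j : (mu (block_bad S h q j) <= (K * g ^+ j)%:E)%E.
  apply: le_trans (measureU_seq_le _ _ _) _; first by move=> i; exact: measurable_bad_set.
  apply: (@le_trans _ _ (\sum_(i <- iota (2 ^ q) (2 ^ q)) (C * g ^+ (q + j) * (2 ^+ q) ^+ 2)%:E)%E).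
    rewrite big_seq [leRHS]big_seq; apply: lee_sum => i; rewrite mem_iota => iq.
    have LN : (2 ^ (q + j) <= i * 2 ^ j < 2 ^ (q + j).+1)%N.
      rewrite -addSn !expnD leq_mul2r ltn_pmul2r ?expn_gt0// expnS mul2n -addnn.
      by case/andP: iq => -> ->; rewrite orbT.
    have N0 : (0 < i * 2 ^ j)%N by case/andP: LN => LN _; apply: leq_trans LN; rewrite expn_gt0.
    apply: le_trans (bad_set_le _ _ _ N0) _; first by rewrite invr_gt0 exprn_gt0.
    rewrite lee_fin; have N0' : 0 < (i * 2 ^ j)%:R :> R by rewrite ltr0n.
    rewrite ler_pdivrMr ?exprn_gt0 ?mulr_gt0 ?invr_gt0 ?exprn_gt0//.
    apply: le_trans (H _ _ LN) _; rewrite le_eqVlt; apply/orP; left; apply/eqP.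
    by move: ((i * 2 ^ j)%:R : R) => z; field; rewrite expf_neq0.
  rewrite sumEFin big_const_seq count_predT size_iota iter_addr addr0 lee_fin /K.
  by rewrite -[_ *+ _]mulr_natl exprD le_eqVlt; apply/orP; left; apply/eqP; ring.
apply: (@le_lt_trans _ _ (K / (1 - g))%:E); last exact: ltry.
apply: lime_le; first exact: is_cvg_nneseries.
apply: nearW => n; apply: (@le_trans _ _ (\sum_(0 <= j < n) (K * g ^+ j)%:E)%E).
  exact: lee_sum.
rewrite sumEFin lee_fin -mulr_sumr; apply: ler_wpM2l => //.
rewrite -[leRHS]mul1r ler_pdivlMr ?subr_gt0//.
suff -> : (\sum_(0 <= j < n) g ^+ j) * (1 - g) = 1 - g ^+ n by rewrite gerBl exprn_ge0.
elim: n => [|n IH]; first by rewrite big_geq// mul0r expr0 subrr.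
by rewrite big_nat_recr//= mulrDl IH exprSr; ring.
Qed.

(** * Return from truncations to the real number *)

Definition value (t : oseq b) : R := limn (fun M => prefix_value R M t).

Lemma prefix_valueS M (t : oseq b) :
  prefix_value R M.+1 t = prefix_value R M t + (t M)%:R * b%:R ^- M.+1.
Proof. by rewrite /prefix_value big_nat_recr. Qed.

Lemma prefix_value_incr (t : oseq b) :
  {homo (fun M => prefix_value R M t) : m n / (m <= n)%N >-> m <= n}.
Proof.
apply/nondecreasing_seqP => M; rewrite prefix_valueS lerDl mulr_ge0// invr_ge0 ltW//.
Qed.

(** The upper ends of the b-adic intervals decrease, since a digit is at most b - 1. *)
Lemma prefix_value_tail (t : oseq b) m n : (m <= n)%N ->
  prefix_value R n t + b%:R ^- n <= prefix_value R m t + b%:R ^- m.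
Proof.
move=> mn; rewrite -(subnK mn); elim: (n - m)%N => // k IH.
apply: le_trans IH; rewrite addSn prefix_valueS -addrA lerD2l.
have tb : (t (k + m)%N)%:R + 1 <= b%:R :> R.
  by rewrite natr1 ler_nat; have := ltn_ord (t (k + m)%N); move: b_ge2; clear; lia.
rewrite [leLHS](_ : _ = ((t (k + m)%N)%:R + 1) / b%:R ^+ (k + m).+1); last by ring.
rewrite ler_pdivrMr// exprS [b%:R * _]mulrC mulrA mulVf ?gt_eqF// mul1r.
exact: tb.
Qed.

Lemma prefix_value_is_cvg (t : oseq b) : cvgn (fun M => prefix_value R M t).
Proof.
have ub : has_ubound (range (fun M => prefix_value R M t)).
  exists 1 => _ [M _ <-]; have := prefix_value_tail t (leq0n M).
  rewrite {2}/prefix_value big_geq// add0r expr0 invr1.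
  by apply: le_trans; rewrite lerDl invr_ge0 ltW.
exact: (nondecreasing_is_cvgn (prefix_value_incr t) ub).
Qed.

Lemma value_cvg (t : oseq b) : prefix_value R M t @[M --> \oo] --> value t.
Proof. exact: prefix_value_is_cvg. Qed.

Lemma value_prefix (t : oseq b) M : `|value t - prefix_value R M t| <= b%:R ^- M.
Proof.
have h1 : prefix_value R M t <= value t.
  exact: (nondecreasing_cvgn_le (prefix_value_incr t) (@prefix_value_is_cvg t) M).
have h2 : value t <= prefix_value R M t + b%:R ^- M.
  apply: limr_le; first exact: prefix_value_is_cvg.
  exists M => // n /= Mn; apply: le_trans (prefix_value_tail t Mn).
  by rewrite lerDl invr_ge0 ltW.
by rewrite ger0_norm ?subr_ge0// lerBlDl.
Qed.

(** Truncation changes each argument by at most h S^N b^-M <= 1 / N, hence the N terms by a bounded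
    total. *)
Lemma weyl_sum_value S h N (t : oseq b) : (1 < S)%N ->
  weyl_sum S h N (value t) <=
  weyl_sum S h N (prefix_value R (trunc_len S h N) t) + 2 * (pi *+ 2).
Proof.
move=> S1; set M := trunc_len S h N; set x := prefix_value R M t.
have S0 : 0 < S%:R :> R by rewrite ltr0n ltnW.
have p0 : 0 <= 2 * (pi *+ 2) :> R by rewrite mulr_ge0// mulrn_wge0// pi_ge0.
rewrite -lerBlDl; apply: le_trans (_ : normc (\sum_(n < N)
    (cis (h%:R * (S%:R ^+ n * value t)) - cis (h%:R * (S%:R ^+ n * x)))) <= _).
  rewrite lerBlDl /weyl_sum; apply: le_trans (normcD _ _).
  by rewrite sumrB addrC subrK.
apply: le_trans (normc_sum _ _ _) _.
apply: (@le_trans _ _ (\sum_(n < N) 2 * (pi *+ 2) * N%:R^-1)); last first.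
  rewrite sumr_const card_ord -[_ *+ N]mulr_natr.
  by have [->|N0] := posnP N; rewrite ?mulr0// divfK// pnatr_eq0 -lt0n.
apply: ler_sum => n _; apply: le_trans (normc_cisB _ _) _; apply: ler_wpM2l => //.
apply: le_trans (nint_dist_le_norm _) _.
rewrite -!mulrBr !normrM normrX !normr_nat.
have N0 : 0 < N%:R :> R by rewrite ltr0n; apply: leq_ltn_trans (ltn_ord n).
apply: (@le_trans _ _ (h%:R * (S%:R ^+ N * b%:R ^- M))).
  apply: ler_wpM2l => //; apply: ler_pM; rewrite ?exprn_ge0 ?normr_ge0//.
    by apply: ler_weXn2l; [rewrite ler1n ltnW|exact/ltnW/ltn_ord].
  exact: value_prefix.
rewrite mulrA ler_pdivrMr// ler_pdivlMl//.
have lM := trunc_len_large h N (ltnW S1).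
rewrite -!natrX -!natrM ler_nat -/M; apply: leq_trans (ltnW lM).
apply: (@leq_trans (h * S ^ (2 * N))%N); last by rewrite leq_pmull// muln_gt0 expn_gt0 (ltnW b_ge2).
rewrite mulnCA leq_mul2l (_ : 2 * N = N + N)%N; last by clear; lia.
by rewrite expnD leq_mul2r (ltnW (ltn_expl _ S1)) !orbT.
Qed.

Lemma weyl_sum_extend S h N N' (x : R) : (N' <= N)%N ->
  weyl_sum S h N x <= weyl_sum S h N' x + (N - N')%:R.
Proof.
move=> NN'; pose F n := cis (h%:R * (S%:R ^+ n * x)).
rewrite /weyl_sum -(big_mkord xpredT F) (@big_cat_nat _ _ _ N')//= big_mkord.
apply: le_trans (normcD _ _) _; rewrite lerD2l.
apply: le_trans (normc_sum _ _ _) _; under eq_bigr do rewrite normc_cis.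
by rewrite sumr_const_nat.
Qed.

(** N is compared with the largest multiple i 2^j <= N. The sampled sum, the truncation and the
    leftover terms cost at most 2^-q N each, and 3 2^-q <= e. *)
Lemma weyl_small_value S (t : oseq b) : (1 < S)%N ->
  (forall h q, ~ lim_sup_set (block_bad S h.+1 q) t) ->
  weyl_small (fun n => S%:R ^+ n * value t).
Proof.
move=> S1 nb h h0 e e0.
pose q := (Num.truncn (3 / e)).+1.
have qe : 3 * 2 ^- q <= e.
  have : 3 / e < q%:R by case/andP: (truncn_itv (ltW (divr_gt0 (ltr0Sn R 2) e0))).
  have : q%:R <= 2 ^+ q :> R by rewrite -natrX ler_nat; exact/ltnW/ltn_expl.
  move=> h1 h2; rewrite ler_pdivrMr ?exprn_gt0// mulrC -ler_pdivrMr//.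
  exact: le_trans (ltW h2) h1.
have [J hJ] : exists J, forall j, (J <= j)%N -> ~ block_bad S h q j t.
  apply: contrapT => no; apply: (nb h.-1 q); rewrite prednK// => J _.
  apply: contrapT => no'; apply: no; exists J => j Jj bj; apply: no'.
  by exists j.
pose c : R := 2 * (pi *+ 2) * 2 ^+ q.
have c0 : 0 <= c by rewrite mulr_ge0 ?exprn_ge0// mulr_ge0// mulrn_wge0// pi_ge0.
exists (maxn (2 ^ (q + J)) (Num.truncn c).+1) => N; rewrite geq_max => /andP[NJ Nc].
pose L := trunc_log 2 N.
have N0 : (0 < N)%N by apply: leq_trans NJ; rewrite expn_gt0.
have LN : (2 ^ L <= N < 2 ^ L.+1)%N by exact: trunc_log_bounds.
have qL : (q + J <= L)%N by apply: trunc_log_max.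
pose j := (L - q)%N; pose i := (N %/ 2 ^ j)%N.
have jL : (2 ^ L = 2 ^ q * 2 ^ j)%N by rewrite -expnD; congr (_ ^ _)%N; rewrite /j; lia.
have iq : i \in iota (2 ^ q) (2 ^ q).
  rewrite mem_iota addnn -mul2n -expnS /i leq_divRL ?expn_gt0// ltn_divLR ?expn_gt0//.
  by rewrite -jL expnS -mulnA -jL -expnS.
have iN : (i * 2 ^ j <= N)%N by exact: leq_trunc_div.
have Ni : (N - i * 2 ^ j <= 2 ^ j)%N.
  by have := ltn_ceil N (expn_gt0 2 j : (0 < 2 ^ j)%N); rewrite -/i mulSn; lia.
have good_N : weyl_sum S h (i * 2 ^ j) (prefix_value R (trunc_len S h (i * 2 ^ j)) t)
    <= 2 ^- q * (i * 2 ^ j)%:R.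
  rewrite leNgt; apply/negP => /ltW bt; apply: (hJ j); first by rewrite /j; lia.
  by rewrite /block_bad -bigcup_seq; exists i.
apply: le_trans (weyl_sum_extend _ _ _ iN) _.
have w1 := weyl_sum_value h (i * 2 ^ j) t S1.
have e1 : 2 ^- q * (i * 2 ^ j)%:R <= 2 ^- q * N%:R :> R.
  by apply: ler_wpM2l; rewrite ?invr_ge0 ?exprn_ge0// ler_nat.
have e2 : (N - i * 2 ^ j)%:R <= 2 ^- q * N%:R :> R.
  rewrite ler_pdivlMl ?exprn_gt0// -natrX -natrM ler_nat.
  apply: (@leq_trans (2 ^ q * 2 ^ j)%N); first by rewrite leq_mul2l Ni orbT.
  by rewrite -jL; case/andP: LN.
have e3 : 2 * (pi *+ 2) <= 2 ^- q * N%:R :> R.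
  rewrite ler_pdivlMl ?exprn_gt0// mulrC -/c; apply: le_trans (_ : (Num.truncn c).+1%:R <= _).
    by apply: ltW; case/andP: (truncn_itv c0).
  by rewrite ler_nat.
have e4 : 3 * 2 ^- q * N%:R <= e * N%:R by apply: ler_wpM2r.
rewrite -mulrA in e4; move: w1 good_N e1 e2 e3 e4.
move: (2 ^- q * N%:R) => z; lra.
Qed.

(** S is replaced by the power S^a of [base_decomposition], and the exceptional sets for the
    countably many h and q are united. *)
Lemma ae_weyl S : (1 < S)%N -> mu.-negligible
  [set t | ~ weyl_small (fun n => S%:R ^+ n * value t)].
Proof.
move=> S1; have [a [r [S1' [a0 SE S1P]]]] := base_decomposition b_ge2 S1.
have Sa1 : (1 < S ^ a)%N by rewrite -(exp1n a) ltn_exp2r.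
apply: (@negligibleS _ _ _ mu
  (\bigcup_h \bigcup_q lim_sup_set (block_bad (S ^ a) h.+1 q))).
  move=> t /= nw; apply: contrapT => nb; apply: nw.
  apply: (weyl_small_power a0 (ltnW S1)); apply: weyl_small_value => // h q bt.
  by apply: nb; exists h => //; exists q.
apply: negligible_bigcup => h; apply: negligible_bigcup => q.
exists (lim_sup_set (block_bad (S ^ a) h.+1 q)); split=> //.
  apply: bigcapT_measurable => n; apply: bigcup_measurable => j _.
  exact: measurable_block_bad.
exact: (limsup_block_bad q Sa1 SE).
Qed.

End almost_everywhere.

Theorem theorem2 (R : realType) (b : nat) (b_ge2 : (2 <= b)%N)
    (lambda : probability (oseq b) R) (lambdaP : uniform_product lambda) :
  {ae toeplitz_measure lambda, forall t : oseq b,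
    T2 b t -> exists x : R, represents t x /\ absolutely_normal x}.
Proof.
(* [distribution] is the same push-forward equipped with its measure structure. One null set for
   each base k + 2 covers all powers s^k at once. *)
apply: (@negligibleS _ _ _ (distribution lambda (@toeplitz b))
  (\bigcup_k [set t | ~ weyl_small (fun n => k.+2%:R ^+ n * @value R b t)])); last first.
  by apply: negligible_bigcup => k; exact: ae_weyl.
move=> t /= nt; apply: contrapT => nb; apply: nt => _.
exists (value R t); split; first exact: value_cvg.
move=> s s2 k k0; have sk : (1 < s ^ k)%N by rewrite -(exp1n k) ltn_exp2r.
apply: simply_normal_of_weyl; first exact: ltnW.
apply: contrapT => nw; apply: nb; exists (s ^ k).-2 => //=.
by rewrite !prednK//; lia.
Qed.
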